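(* Let $\mathcal{G}$ be a finite connected $r$-regular non-bipartite graph on $k$ vertices $v_1,\dots,v_k$, directed or not, possibly with self-loops and multiple edges. Let $\mathbf{f}:V(\mathcal{G})\to\mathbf{R}$ be a function. For each $N$ let $W_N$ be the set of all closed walks (circuits) of length $N$ on $\mathcal{G}$, with the uniform probability measure, and let $X_{\mathbf f}$ be the random variable on $W_N$ given by $X_{\mathbf f}(w)=\sum_{l=1}^N\mathbf{f}(w_l)$ for a closed walk $w$ visiting successively the vertices $w_1,\dots,w_N$. Then, as $N\to\infty$, the distribution of $$\frac{X_{\mathbf f}-N\mu(\mathbf f)}{\sqrt N}$$ converges to the normal distribution with mean $0$ and variance $$\sigma^2(\mathbf f)=\frac1k\left[-\|\mathbf f_0\|^2+2r\,\mathbf f_0^t\,\Delta_0^{-1}(\mathcal G)\,\mathbf f_0\right]=\frac1k\left[\mathbf f_0^t\left(-\mathbf I_0+2r\Delta_0^{-1}(\mathcal G)\right)\mathbf f_0\right].$$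
   Context: The adjacency matrix $A(\mathcal G)$ has $ij$ entry the number of edges from the $i$-th to the $j$-th vertex (it is symmetric if $\mathcal G$ is undirected; a self-loop contributes $1$ to the diagonal entry). $r$-regular means that all row sums and column sums of $A(\mathcal G)$ equal $r$. Closed walks have a basepoint and are counted with multiplicity of edges, so that $|W_N|=\operatorname{tr}A(\mathcal G)^N$. Functions on vertices are identified with vectors in $\mathbf R^k$. Put $\mu(\mathbf f)=\frac1k\sum_{j=1}^k\mathbf f(v_j)$ and $\mathbf f_0=\mathbf f-\mu(\mathbf f)\mathbf 1$, where $\mathbf 1$ is the all-ones vector. The Laplacian is $\Delta(\mathcal G)=r\mathbf I-A(\mathcal G)$; $\Delta_0(\mathcal G)$ is $\Delta(\mathcal G)$ viewed as an operator on the orthogonal complement of $\mathbf 1$ (vectors with zero sum), and $\mathbf I_0$ is the identity on that complement. A normal distribution of variance $0$ is the point mass at $0$. *)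

(* Defs.v *)
From HB Require Import structures.
From mathcomp Require Import all_boot all_order all_algebra.
From mathcomp Require Import all_classical all_reals all_analysis.

Set Implicit Arguments.
Unset Strict Implicit.
Unset Printing Implicit Defensive.

Import Order.TTheory GRing.Theory Num.Theory.
Import numFieldNormedType.Exports.

Local Open Scope classical_set_scope.
Local Open Scope ring_scope.

(* A finite directed multigraph (self-loops allowed) on the vertices 'I_k.
   An undirected multigraph is the digraph having two opposite arcs for each
   non-loop edge and a single arc for each self-loop: it has the same adjacency
   matrix and the same closed walks, counted with edge multiplicity. *)
Record digraph (k : nat) := Digraph {
  edge : finType;
  source : edge -> 'I_k;
  target : edge -> 'I_k }.

Section Graph.
Variables (k : nat) (G : digraph k).

Definition mult (i j : 'I_k) : nat :=
  #|[pred e : edge G | (source e == i) && (target e == j)]|.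

Definition undirected : Prop := forall i j, mult i j = mult j i.

Definition regular (r : nat) : Prop :=
  (forall i, (\sum_(j < k) mult i j)%N = r) /\
  (forall j, (\sum_(i < k) mult i j)%N = r).

(* Connectedness of the underlying undirected graph; for a regular digraph it
   is equivalent to strong connectedness. *)
Definition connected_graph : Prop :=
  forall i j,
    connect [rel x y | (0 < mult x y)%N || (0 < mult y x)%N] i j.

Definition bipartite : Prop :=
  exists c : 'I_k -> bool, forall e : edge G, c (source e) != c (target e).

(* A closed walk is its cyclic sequence of arcs, based at the source of the
   first one.  Only lengths N > 0 are meaningful: for N = 0 this is the single
   empty tuple, not one walk per vertex. *)
Definition closed_walks (N : nat) : {set N.-tuple (edge G)} :=
  [set w : N.-tuple (edge G) | cycle [rel e e' | target e == source e'] w]%SET.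

Definition walk_sum (R : realType) (f : 'I_k -> R) (N : nat)
    (w : N.-tuple (edge G)) : R :=
  \sum_(l < N) f (source (tnth w l)).

End Graph.

Section Variance.
Variables (R : realType) (k : nat).

Definition mean (f : 'I_k -> R) : R := k%:R^-1 * \sum_(j < k) f j.

Definition centered (f : 'I_k -> R) : 'cV[R]_k := \col_j (f j - mean f).

(* The orthogonal complement of the all-ones vector. *)
Definition zero_sum : {vspace 'cV[R]_k} :=
  lker (linfun (mulmx (const_mx 1 : 'rV[R]_k)) : 'Hom('cV[R]_k, 'cV[R]_1)).

Variable G : digraph k.

Definition adjacency : 'M[R]_k := \matrix_(i, j) (mult G i j)%:R.

Definition laplacian (r : nat) : 'M[R]_k := r%:R%:M - adjacency.

(* For an r-regular graph the Laplacian maps zero_sum to itself, so that vsproj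
   only retypes its values. *)
Definition laplacian0 (r : nat) : 'End(subvs_of zero_sum) :=
  (linfun (vsproj zero_sum) \o linfun (mulmx (laplacian r))
     \o linfun (vsval : subvs_of zero_sum -> 'cV[R]_k))%VF.

(* f_0^t T f_0 for an operator T on zero_sum (which contains f_0). *)
Definition quad0 (T : 'End(subvs_of zero_sum)) (f : 'I_k -> R) : R :=
  ((centered f)^T *m vsval (T (vsproj zero_sum (centered f)))) 0 0.

Definition sigma2 (r : nat) (f : 'I_k -> R) : R :=
  k%:R^-1 * (- (\sum_(j < k) centered f j 0 ^+ 2)
             + 2 * r%:R * quad0 (laplacian0 r)^-1%VF f).

End Variance.

Section Law.
Variable R : realType.

(* The distribution of Y under the uniform probability on W; it is only
   meaningful if W is nonempty. *)
Definition unif_law (T : finType) (W : {set T}) (Y : T -> R) (B : set R) :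
    \bar R :=
  (#|[pred w in W | Y w \in B]|%:R / #|W|%:R)%:E.

(* The centered normal law of variance v >= 0.  The library's normal_prob takes
   the standard deviation and is not the point mass when that is 0. *)
Definition normal_law (v : R) : set R -> \bar R :=
  if v == 0 then \d_(0 : R) else normal_prob 0 (Num.sqrt v).

(* Convergence in distribution: pointwise convergence of the distribution
   functions at the continuity points of the limit. *)
Definition cvg_in_law (F : set_system nat) (mu : nat -> set R -> \bar R)
    (nu : set R -> \bar R) : Prop :=
  forall x : R,
    {for x, continuous (fun t : R => nu `]-oo, t]%classic)} ->
    mu N `]-oo, x]%classic @[N --> F] --> nu `]-oo, x]%classic.

End Law.

(* Main.v *)
(* Let P = A/r (doubly stochastic), g = f - mean f, and let h, b solve the Poisson
   equations h - P h = g and b - P b = v - sigma^2, where v is the conditional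
   variance of h(w_(l+1)) - P h(w_l).  The Gaussian distribution function
   H(s,z) = Phi(z / sqrt s) solves the heat equation H_s = H_zz / 2, so Lindeberg's
   telescoping argument runs on H itself: with s = e^2 + sigma^2 l/N for l remaining
   steps and z = x - y - h(i)/sqrt N, the function H(s,z) + b(i)/(2N) H_zz(s,z) is
   invariant under one step of the chain up to O(N^(-3/2)).  This is the central
   limit theorem for H(e^2, x - .) and an arbitrary starting vertex.
   Closing up the walk does not affect the limit: since |P^L u|^2 decreases in L, the
   martingale P^(N-l) u(w_l) is nearly constant except during the last L steps,
   which do not matter at scale sqrt N.  So the constraint w_(N+1) = w_1 factors out
   as the return probability, which is bounded below along the lengths where it is
   positive because the zero pattern of P^N is eventually periodic.  Neither a
   spectral gap nor aperiodicity is used.  Finally e = d^2, d -> 0 turns the smooth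
   test functions into indicators, also when sigma = 0. *)
Require Import Defs.
From HB Require Import structures.
From mathcomp Require Import all_boot all_order all_algebra.
From mathcomp Require Import all_classical all_reals all_analysis.
From mathcomp Require Import ring lra.
Import Order.TTheory GRing.Theory Num.Theory.
Import numFieldNormedType.Exports.
Local Open Scope classical_set_scope.
Local Open Scope ring_scope.

(** * The Gaussian distribution function and the heat equation *)

Lemma derivable_lipschitz_segment {R : realType} (f df : R -> R) (a b K : R) :
    a <= b -> (forall x, a <= x <= b -> is_derive x 1 f (df x)) ->
    (forall x, a <= x <= b -> `|df x| <= K) ->
  `|f b - f a| <= K * (b - a).
Proof.
move=> ab Df bound.
have [c cab ->] : exists2 c, c \in `[a, b] & f b - f a = df c * (b - a).
  apply: MVT_segment => // [x|].
    by rewrite in_itv/= => /andP[/ltW xa /ltW xb]; apply: Df; rewrite xa.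
  apply/continuous_in_subspaceT => x; rewrite inE/= in_itv/= => xab.
  by apply/differentiable_continuous/derivable1_diffP; have := Df _ xab; case.
rewrite normrM (ger0_norm (x := b - a)) ?subr_ge0//.
by apply: ler_wpM2r; [rewrite subr_ge0 | apply: bound; rewrite in_itv/= in cab].
Qed.

(** Applied repeatedly, starting from a bound on the highest derivative, it yields the Taylor
    remainders of [heat_bounds]. *)
Lemma derivable_increment_le {R : realType} (f df : R -> R) (a K : R) :
    (forall x : R, is_derive x 1 f (df x)) ->
    (forall x, `|x| <= `|a| -> `|df x| <= K) ->
  `|f a - f 0| <= K * `|a|.
Proof.
move=> Df bound; have [a0|/ltW a0] := leP 0 a.
  rewrite (ger0_norm a0) -[leRHS]/(K * a) -[X in K * X]subr0.
  apply: derivable_lipschitz_segment => // x /andP[x0 xa].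
  by apply: bound; rewrite !ger0_norm.
rewrite distrC (ler0_norm a0) -[- a]add0r; apply: derivable_lipschitz_segment => // x /andP[x0 xa].
by apply: bound; rewrite !ler0_norm// lerN2.
Qed.

(** [s] is the standard deviation, whereas [heat] below takes the variance. *)
Definition ndist {R : realType} (s x : R) : R :=
  fine (normal_prob 0 s `]-oo, x]%classic).

Definition npdf {R : realType} (w : R) : R := normal_peak 1 * expR (- w ^+ 2 / 2).

Definition npdf1 {R : realType} (w : R) : R := - w * npdf w.

Section NormalDistributionFunction.
Context {R : realType}.
Implicit Types s x w : R.

Lemma ndistE s x : normal_prob 0 s `]-oo, x]%classic = (ndist s x)%:E.
Proof. by rewrite /ndist fineK// fin_num_measure. Qed.

Lemma ndist_ge0 s x : 0 <= ndist s x.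
Proof. by rewrite -lee_fin -ndistE. Qed.

Lemma ndist_le1 s x : ndist s x <= 1.
Proof. by rewrite -lee_fin -ndistE probability_le1. Qed.

Lemma ndist_mono s : {homo ndist s : x y / x <= y}.
Proof.
move=> x y xy; rewrite -lee_fin -!ndistE le_measure ?inE//.
exact: subitvPr.
Qed.

(** Under the normal law the identity is a random variable with distribution function [ndist], so
    the limits of distribution functions at infinity apply. *)
Let idTR : measurableTypeR R -> R := idfun.

#[local] HB.instance Definition _ :=
  @isMeasurableFun.Build _ _ _ _ idTR (@measurable_id _ _ setT).

Let id_rv s := (idTR : {RV (normal_prob (0:R) s) >-> R}).

Lemma cvg_ndist_pinfty s : ndist s x @[x --> +oo] --> (1 : R).
Proof.
have := cvg_cdfy1 (id_rv s) => /fine_cvg; exact.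
Qed.

Lemma cvg_ndist_ninfty s : ndist s x @[x --> -oo] --> (0 : R).
Proof.
have := cvg_cdfNy0 (id_rv s) => /fine_cvg; exact.
Qed.

Lemma is_derive_ndist s x : s != 0 -> is_derive x 1 (ndist s) (normal_pdf 0 s x).
Proof.
move=> s0.
have int : lebesgue_measure.-integrable `]-oo, (x + 1)] (EFin \o normal_pdf 0 s).
  exact: integrableS (integrable_normal_pdf 0 s).
have [] := @continuous_FTC1 R (normal_pdf 0 s) -oo%O x (x + 1) _ int (ltNyr x) _.
- by rewrite ltrDl.
- exact: continuous_normal_pdf.
move=> D E; rewrite -E derive1E; exact: derivableP D.
Qed.

Lemma npdfE w : normal_pdf 0 1 w = npdf w.
Proof.
by rewrite /normal_pdf oner_eq0 /npdf /normal_fun subr0 expr1n.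
Qed.

#[local] Instance is_derive_ndist1 x : is_derive x 1 (ndist (1:R)) (npdf x).
Proof. by rewrite -npdfE; apply: is_derive_ndist; rewrite oner_eq0. Qed.

(** Both sides have the same derivative in [x], so they differ by a constant, which is 0 because
    both tend to 0 at -oo. *)
Lemma ndist_scale s x : 0 < s -> ndist s x = ndist 1 (x / s).
Proof.
move=> s0; have sn0 : s != 0 by rewrite gt_eqF.
pose d y := ndist s y - ndist 1 (y / s).
suff d0 y : d y = 0 by apply/eqP; rewrite -subr_eq0; apply/eqP/d0.
have dcst z : d z = d y.
  apply: is_derive_0_is_cst => t.
  have D1 := is_derive_ndist s t sn0.
  have D2 : is_derive t 1 (fun t => t / s) s^-1.
    rewrite (_ : (fun t => t / s) = (s^-1 *: (@id R))); last first.
      by apply/funext => u /=; rewrite mulrC.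
    by apply: is_derive_eq; rewrite scaler1.
  have D3 := @is_derive1_comp _ (ndist 1) (fun t => t / s) t _ _
    (is_derive_ndist1 (t / s)) D2.
  rewrite (_ : d = ndist s - (ndist 1 \o (fun t => t / s)))//.
  apply: is_derive_eq; rewrite normal_pdfE// /npdf /normal_peak /normal_fun.
  rewrite subr0 expr1n mul1r.
  rewrite -mulrnAr sqrtrM ?sqr_ge0// sqrtr_sqr (gtr0_norm s0) invfM.
  apply/eqP; rewrite subr_eq0; apply/eqP.
  rewrite [RHS]mulrAC [RHS]mulrC [RHS]mulrC; congr (_ * expR _); first by rewrite mulrC.
  by rewrite expr_div_n -mulr_natr invfM mulrA mulNr.
have dlim : d z @[z --> -oo] --> 0 - (0 : R).
  apply: cvgB; first exact: cvg_ndist_ninfty.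
  apply: (@cvg_comp _ _ _ (fun t => t / s) (ndist 1) _ -oo); last exact: cvg_ndist_ninfty.
  apply: gt0_cvgMlNy; [by rewrite invr_gt0 | exact: cvg_id].
rewrite subr0 in dlim.
suff : d z @[z --> -oo] --> d y by move=> /(cvg_unique (@Rhausdorff R) dlim).
rewrite (_ : d = cst (d y)); first exact: cvg_cst.
by apply/funext => z; rewrite dcst.
Qed.

End NormalDistributionFunction.

(* The probability that a centered normal variable of variance s > 0 is <= z; as a
   function of z it is a smoothed indicator that the heat semigroup preserves. *)
Definition heat {R : realType} (s z : R) : R := ndist 1 (z * (Num.sqrt s)^-1).
(** [heat1] and [heat2] are the first and second derivatives of [heat] in [z]. *)
Definition heat1 {R : realType} (s z : R) : R :=
  npdf (z * (Num.sqrt s)^-1) * (Num.sqrt s)^-1.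
Definition heat2 {R : realType} (s z : R) : R :=
  npdf1 (z * (Num.sqrt s)^-1) * (Num.sqrt s)^-1 ^+ 2.

Section HeatKernel.
Context {R : realType}.
Implicit Types s z w a d : R.

(** [npdf2] and [npdf3] are the second and third derivatives of the standard density [npdf]. *)
Let npdf2 w : R := (w ^+ 2 - 1) * npdf w.
Let npdf3 w : R := (3 * w - w ^+ 3) * npdf w.

Lemma is_derive_npdf w : is_derive w 1 (npdf : R -> R) (npdf1 w).
Proof.
have D : is_derive w 1 (fun w : R => - w ^+ 2 / 2) (- w).
  rewrite (_ : (fun w => _) = (- 2^-1) *: (@id R ^+ 2)); last first.
    by apply/funext => x /=; rewrite mulrC mulrN -mulNr.
  by apply: is_derive_eq; rewrite /GRing.scale /= expr1; field.
have D2 := @is_derive1_comp _ expR (fun w : R => - w ^+ 2 / 2) w _ _ (is_derive_expR _) D.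
rewrite (_ : npdf = normal_peak 1 *: (expR \o (fun w : R => - w ^+ 2 / 2)))//.
by apply: is_derive_eq; rewrite /npdf1 /npdf /GRing.scale /=; ring.
Qed.

Lemma is_derive_npdf1 w : is_derive w 1 (npdf1 : R -> R) (npdf2 w).
Proof.
have D := is_derive_npdf w.
rewrite (_ : npdf1 = - @id R * npdf)//.
apply: is_derive_eq; rewrite /npdf2 /npdf1 /GRing.scale /=.
rewrite (_ : (- id) w = - w)//; ring.
Qed.

Lemma is_derive_scale (F : R -> R) (F' u c z : R) :
  is_derive (z * u) 1 F F' -> is_derive z 1 (fun z => F (z * u) * c) (F' * u * c).
Proof.
move=> DF.
have D : is_derive z 1 (fun z : R => z * u) u.
  rewrite (_ : (fun z => z * u) = u *: @id R); last by apply/funext => x /=; rewrite mulrC.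
  by apply: is_derive_eq; rewrite scaler1.
have DFz := @is_derive1_comp _ F (fun z : R => z * u) z _ _ DF D.
rewrite (_ : (fun z => _) = c *: (F \o (fun z : R => z * u))); last first.
  by apply/funext => x /=; rewrite mulrC.
by apply: is_derive_eq; rewrite /GRing.scale /=; ring.
Qed.

Lemma is_derive_invsqrt s : 0 < s ->
  is_derive s 1 (fun s => (Num.sqrt s)^-1) (- 2^-1 * (Num.sqrt s)^-1 ^+ 3).
Proof.
move=> s0; have r0 : Num.sqrt s != 0 by rewrite gt_eqF// sqrtr_gt0.
have D := is_derive1_sqrt s0.
have D2 := is_deriveV r0 D.
by apply: is_derive_eq; rewrite /GRing.scale /=; field.
Qed.

(** The heat equation H_s = H_zz / 2: for w = z s^(-1/2) one has dw/ds = -w / (2s), so Phi(w) has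
    s-derivative -w phi(w) / (2s). *)
Lemma is_derive_heat_l s z : 0 < s ->
  is_derive s 1 (fun s => heat s z) (2^-1 * heat2 s z).
Proof.
move=> s0; have D := is_derive_invsqrt s s0.
have D2 : is_derive s 1 (fun s => z * (Num.sqrt s)^-1)
    (z * (- 2^-1 * (Num.sqrt s)^-1 ^+ 3)).
  rewrite (_ : (fun s => _) = z *: (fun s : R => (Num.sqrt s)^-1))//.
  exact: is_derive_eq.
have D3 := @is_derive1_comp _ (ndist 1) (fun s : R => z * (Num.sqrt s)^-1) s _ _
  (is_derive_ndist1 _) D2.
by apply: is_derive_eq; rewrite /heat2 /npdf1; ring.
Qed.

(** H_zz solves the heat equation as well; the right side is H_zzzz / 2. *)
Lemma is_derive_heat2_l s z : 0 < s ->
  is_derive s 1 (fun s => heat2 s z)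
    (2^-1 * (npdf3 (z * (Num.sqrt s)^-1) * (Num.sqrt s)^-1 ^+ 4)).
Proof.
move=> s0; have D := is_derive_invsqrt s s0.
have D2 : is_derive s 1 (fun s => z * (Num.sqrt s)^-1)
    (z * (- 2^-1 * (Num.sqrt s)^-1 ^+ 3)).
  rewrite (_ : (fun s => _) = z *: (fun s : R => (Num.sqrt s)^-1))//.
  exact: is_derive_eq.
have D3 := @is_derive1_comp _ npdf1 (fun s : R => z * (Num.sqrt s)^-1) s _ _
  (is_derive_npdf1 _) D2.
rewrite (_ : (fun s => _) = (npdf1 \o (fun s : R => z * (Num.sqrt s)^-1)) *
   (fun s : R => (Num.sqrt s)^-1) ^+ 2)//.
apply: is_derive_eq; rewrite /npdf3 /npdf2 /npdf1 /GRing.scale /= expr1 !fctE.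
by set u := (Num.sqrt s)^-1; field.
Qed.

Let e w : R := expR (- w ^+ 2 / 2).

Let e_bound2 w : w ^+ 2 * e w <= 2.
Proof.
rewrite /e mulNr expRN ler_pdivrMr ?expR_gt0//.
have := expR_ge1Dx (w ^+ 2 / 2); lra.
Qed.

Let e_bound4 w : w ^+ 4 * e w <= 16.
Proof.
rewrite /e mulNr expRN ler_pdivrMr ?expR_gt0//.
(* exp(w^2/2) is the square of exp(w^2/4), which is at least w^2/4; hence the factor 16. *)
have := expR_ge1Dx (w ^+ 2 / 4); set t := expR _ => t1.
have -> : expR (w ^+ 2 / 2) = t * t by rewrite /t -expRD; congr expR; field.
have w0 : 0 <= w ^+ 2 / 4 by rewrite divr_ge0 ?sqr_ge0.
have -> : w ^+ 4 = 16 * ((w ^+ 2 / 4) * (w ^+ 2 / 4)) by field.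
by rewrite ler_pM2l//; apply: ler_pM => //; lra.
Qed.

Lemma npdf_bounds : exists2 C : R, 0 < C & forall w : R,
  [/\ `|npdf w| <= C, `|npdf1 w| <= C, `|npdf2 w| <= C & `|npdf3 w| <= C].
Proof.
have pk : 0 < normal_peak 1 :> R by rewrite normal_peak_gt0 ?oner_eq0.
(* The polynomial factors are at most 3 + 4 w^2 + w^4 in absolute value, which gives 3 + 8 + 16 =
   27; 50 leaves slack. *)
exists (normal_peak 1 * 50) => [|w]; first by rewrite mulr_gt0.
have e0 : 0 <= e w by rewrite expR_ge0.
have e1 : e w <= 1.
  by rewrite /e -[leRHS]expR0 ler_expR mulNr oppr_le0 divr_ge0 ?sqr_ge0.
have E2 := e_bound2 w; have E4 := e_bound4 w.
have key P : `|P| <= 3 + 4 * w ^+ 2 + w ^+ 4 -> `|P * npdf w| <= normal_peak 1 * 50.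
  move=> HP; rewrite /npdf mulrCA normrM gtr0_norm// ler_pM2l// normrM -/(e w) (ger0_norm e0).
  apply: le_trans (ler_wpM2r e0 HP) _; lra.
have w2 : 0 <= w ^+ 2 by rewrite sqr_ge0.
have w4 : 0 <= w ^+ 4 by rewrite exprn_even_ge0.
have w1 : `|w| <= 1 + w ^+ 2.
  by rewrite ler_norml; apply/andP; split; nra.
have w3 : `|w ^+ 3| <= w ^+ 2 + w ^+ 4.
  rewrite exprS mulrC normrM (ger0_norm w2) (_ : w ^+ 2 + w ^+ 4 = w ^+ 2 * (1 + w ^+ 2)); last by ring.
  exact: ler_wpM2l.
split.
- by rewrite -[npdf w]mul1r; apply: key; rewrite normr1; lra.
- by apply: key; rewrite normrN; lra.
- by apply: key; rewrite (le_trans (ler_normB _ _))// normr1 ger0_norm//; lra.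
- by apply: key; rewrite (le_trans (ler_normB _ _))// normrM (@ger0_norm _ 3)//; lra.
Qed.

(** A z-derivative of order n carries the factor s^(-n/2), and by the heat equation an s-derivative
    counts as two z-derivatives. Hence one constant serves all s >= s0. *)
Lemma heat_bounds s0 : 0 < s0 -> exists2 C : R, 0 < C & forall s z a d,
    s0 <= s -> 0 <= d ->
  [/\ `|heat2 s z| <= C,
      `|heat s (z + a) - heat s z| <= C * `|a|,
      `|heat s (z + a) - heat s z - a * heat1 s z - a ^+ 2 / 2 * heat2 s z|
        <= C * `|a| ^+ 3,
      `|heat2 s (z + a) - heat2 s z| <= C * `|a|
    & `|heat (s + d) z - heat s z - d / 2 * heat2 s z| <= C * d ^+ 2 /\
      `|heat2 (s + d) z - heat2 s z| <= C * d].
Proof.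
move=> s00; have [K K0 HK] := npdf_bounds.
pose u0 := (Num.sqrt s0)^-1.
have u00 : 0 < u0 by rewrite invr_gt0 sqrtr_gt0.
(* Since 1 + u0 >= 1, its fourth power dominates s^(-n/2) for every order n <= 4. *)
pose C := K * (1 + u0) ^+ 4.
have C0 : 0 < C by rewrite mulr_gt0// exprn_gt0//; lra.
have CK n x (s : R) : s0 <= s -> (n <= 4)%N -> `|x| <= K -> `|x * (Num.sqrt s)^-1 ^+ n| <= C.
  move=> ss n4 xK; have s_gt0 : 0 < s by apply: lt_le_trans ss.
  have uge0 : 0 <= (Num.sqrt s)^-1 by rewrite invr_ge0 sqrtr_ge0.
  rewrite normrM (ger0_norm (x := _ ^+ _)) ?exprn_ge0//.
  apply: ler_pM; rewrite ?exprn_ge0//.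
  apply: (@le_trans _ _ ((1 + u0) ^+ n)).
    apply: lerXn2r; rewrite ?nnegrE//; first lra.
    apply: (@le_trans _ _ u0); last lra.
    by rewrite lef_pV2 ?posrE ?sqrtr_gt0// ler_sqrt// ltW.
  by apply: ler_weXn2l => //; lra.
have F2 s z a : s0 <= s -> `|heat2 s (z + a) - heat2 s z| <= C * `|a|.
  move=> ss; have s_gt0 : 0 < s by apply: lt_le_trans ss.
  have := @derivable_increment_le _ (fun a => heat2 s (z + a))
    (fun a => npdf2 ((z + a) * (Num.sqrt s)^-1) * (Num.sqrt s)^-1 ^+ 3) a C.
  rewrite addr0; apply => x; last by move=> _; apply: CK => //; case: (HK ((z + x) * (Num.sqrt s)^-1)).
  have D := is_derive_scale npdf1 _ (Num.sqrt s)^-1 ((Num.sqrt s)^-1 ^+ 2) (z + x) (is_derive_npdf1 _).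
  have D1 : is_derive x 1 (fun x : R => z + x) 1.
    rewrite (_ : (fun x => _) = cst z + @id R)//.
    by apply: is_derive_eq; rewrite add0r.
  have D2 := @is_derive1_comp _ (heat2 s) (fun x => z + x) x _ _ D D1.
  by apply: is_derive_eq; ring.
have F4 s z d : s0 <= s -> 0 <= d -> `|heat2 (s + d) z - heat2 s z| <= C * d.
  move=> ss d0; have := @derivable_lipschitz_segment _ (fun s => heat2 s z)
    (fun s => 2^-1 * (npdf3 (z * (Num.sqrt s)^-1) * (Num.sqrt s)^-1 ^+ 4)) s (s + d) C.
  rewrite [s + d - s]addrC addKr; apply; first by rewrite lerDl.
    by move=> x /andP[sx _]; apply: is_derive_heat2_l; apply: lt_le_trans sx; apply: lt_le_trans ss.
  move=> x /andP[sx _]; have := CK 4%N (npdf3 (z * (Num.sqrt x)^-1)) x (le_trans ss sx) isT.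
  have [_ _ _ ->] := HK (z * (Num.sqrt x)^-1) => /(_ isT) H.
  by rewrite normrM ger0_norm//; have := normr_ge0 (npdf3 (z / Num.sqrt x) * (Num.sqrt x)^-1 ^+ 4); lra.
have shiftD (F : R -> R) F' z x : is_derive (z + x) 1 F F' -> is_derive x 1 (fun x => F (z + x)) F'.
  move=> D; have D1 : is_derive x 1 (fun x : R => z + x) 1.
    rewrite (_ : (fun x => _) = cst z + @id R)//.
    by apply: is_derive_eq; rewrite add0r.
  have D2 := @is_derive1_comp _ F (fun x => z + x) x _ _ D D1.
  by apply: is_derive_eq; rewrite mulr1.
exists C => // s z a d ss d0; have s_gt0 : 0 < s by apply: lt_le_trans ss.
have Dheat (x : R) : is_derive x 1 (heat s) (heat1 s x).
  have := is_derive_scale (ndist 1) _ (Num.sqrt s)^-1 1 x (is_derive_ndist1 _).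
  by rewrite mulr1 (_ : (fun z => _) = heat s)//; apply/funext => y; rewrite mulr1.
have Dheat1 (x : R) : is_derive x 1 (heat1 s) (heat2 s x).
  have := is_derive_scale npdf _ (Num.sqrt s)^-1 (Num.sqrt s)^-1 x (is_derive_npdf _).
  by rewrite -mulrA -expr2.
split.
- by apply: CK => //; case: (HK (z * (Num.sqrt s)^-1)).
- have := @derivable_increment_le _ (fun a => heat s (z + a)) (fun a => heat1 s (z + a)) a C.
  rewrite addr0; apply => x.
  by move=> _; apply: (CK 1%N) => //; case: (HK ((z + x) * (Num.sqrt s)^-1)).
(* [G1] is the derivative of the cubic remainder [G]; the Lipschitz bound [F2] is integrated
   twice. *)
- pose G1 x := heat1 s (z + x) - heat1 s z - x * heat2 s z.
  have G1b x : `|G1 x| <= C * `|x| ^+ 2.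
    have := @derivable_increment_le _ G1 (fun x => heat2 s (z + x) - heat2 s z) x (C * `|x|).
    rewrite (_ : G1 0 = 0); last by rewrite /G1 addr0 subrr mul0r subrr.
    rewrite subr0 -mulrA -expr2; apply => y.
      have D := shiftD (heat1 s) _ z y (Dheat1 _).
      rewrite (_ : G1 = (fun x => heat1 s (z + x)) - cst (heat1 s z) - heat2 s z *: @id R); last first.
        by apply/funext => t; rewrite /G1 mulrC.
      by apply: is_derive_eq; rewrite subr0 scaler1.
    by move=> yx; apply: le_trans (F2 _ _ _ ss) _; rewrite ler_pM2l.
  pose G x := heat s (z + x) - heat s z - x * heat1 s z - x ^+ 2 / 2 * heat2 s z.
  have := @derivable_increment_le _ G G1 a (C * `|a| ^+ 2).
  rewrite (_ : G 0 = 0); last by rewrite /G addr0 subrr expr0n/= !mul0r !subr0.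
  rewrite subr0 -mulrA -exprSr; apply => y.
    have D := shiftD (heat s) _ z y (Dheat _).
    rewrite (_ : G = (fun x => heat s (z + x)) - cst (heat s z) - heat1 s z *: @id R
        - (heat2 s z / 2) *: (@id R ^+ 2)); last first.
      by apply/funext => t; rewrite /G !fctE /GRing.scale /=; field.
    by apply: is_derive_eq; rewrite /G1 /GRing.scale /= expr1; field.
  move=> yx; apply: le_trans (G1b _) _; rewrite ler_pM2l//.
  by apply: lerXn2r; rewrite ?nnegrE.
- exact: F2.
split; last exact: F4.
pose G x := heat x z - heat s z - (x - s) / 2 * heat2 s z.
have := @derivable_lipschitz_segment _ G (fun x => 2^-1 * (heat2 x z - heat2 s z)) s (s + d) (C * d).
rewrite (_ : G s = 0); last by rewrite /G !subrr !mul0r subr0.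
rewrite subr0 /G.
rewrite (_ : s + d - s = d); last by ring.
rewrite -[C * d * d]mulrA -expr2; apply; first by rewrite lerDl.
  move=> x /andP[sx _]; have D := is_derive_heat_l x z (lt_le_trans s_gt0 sx).
  rewrite (_ : (fun x => _) = (fun x => heat x z) - cst (heat s z) - (heat2 s z / 2) *: (@id R - cst s)); last first.
    by apply/funext => t; rewrite !fctE /GRing.scale /=; field.
  by apply: is_derive_eq; rewrite /GRing.scale /=; field.
move=> x /andP[sx xd]; have := F4 s z (x - s) ss; rewrite subr_ge0 => /(_ sx).
rewrite (_ : s + (x - s) = x) => [H|]; last by ring.
rewrite normrM ger0_norm//.
have : C * (x - s) <= C * d by rewrite ler_pM2l// lerBlDl.
have := normr_ge0 (heat2 x z - heat2 s z); lra.
Qed.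

End HeatKernel.

(** * Markov chains with additive functionals *)

(** The Markov operator P: [iter n (avg p) q i] is the expectation of q(w_(n+1)) for the chain
    started at w_1 = i. *)
Definition avg {R : realType} {k : nat} (p : 'I_k -> 'I_k -> R) (q : 'I_k -> R) :
    'I_k -> R :=
  fun i => \sum_j p i j * q j.

(* iter N (step p c) F i y is the expectation of F(w_(N+1), y + c(w_1) + ... + c(w_N))
   for the chain started at w_1 = i. *)
Definition step {R : realType} {k : nat} (p : 'I_k -> 'I_k -> R) (c : 'I_k -> R)
    (F : 'I_k -> R -> R) : 'I_k -> R -> R :=
  fun i y => \sum_j p i j * F j (y + c i).

Section Chain.
Context {R : realType} {k : nat}.
Variable p : 'I_k -> 'I_k -> R.
Hypothesis p_ge0 : forall i j, 0 <= p i j.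
Hypothesis p_row : forall i, \sum_j p i j = 1.
Implicit Types (q u : 'I_k -> R) (c : 'I_k -> R) (F : 'I_k -> R -> R).

Lemma iter_avg_affine n u w (a b : R) i :
  iter n (avg p) (fun j => a * u j + b * w j) i =
  a * iter n (avg p) u i + b * iter n (avg p) w i.
Proof.
elim: n i => [//|n IH] i; rewrite !iterS /avg !mulr_sumr -big_split/=.
by apply: eq_bigr => j _; rewrite IH; ring.
Qed.

Lemma iter_avg_cst n (a : R) i : iter n (avg p) (fun=> a) i = a.
Proof.
elim: n i => [//|n IH] i; rewrite iterS /avg.
by under eq_bigr do rewrite IH; rewrite -mulr_suml p_row mul1r.
Qed.

Lemma iter_avg_le n u w i : (forall j, u j <= w j) ->
  iter n (avg p) u i <= iter n (avg p) w i.
Proof.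
move=> uw; elim: n i => [//|n IH] i; rewrite !iterS /avg.
by apply: ler_sum => j _; apply: ler_wpM2l.
Qed.

Lemma avg_norm_le (B : R) (u : 'I_k -> R) i : (forall j, `|u j| <= B) ->
  `|\sum_j p i j * u j| <= B.
Proof.
move=> uB; apply: le_trans (ler_norm_sum _ _ _) _.
apply: (@le_trans _ _ (\sum_j p i j * B)).
  by apply: ler_sum => j _; rewrite normrM (ger0_norm (p_ge0 _ _)) ler_wpM2l.
by rewrite -mulr_suml p_row mul1r.
Qed.

Lemma iter_avg_norm_le n (B : R) u i : (forall j, `|u j| <= B) ->
  `|iter n (avg p) u i| <= B.
Proof.
move=> uB; elim: n i => [//|n IH] i; rewrite iterS.
exact: avg_norm_le.
Qed.

Lemma iter_step_dist n c F1 F2 (B : R) i y : (forall j z, `|F1 j z - F2 j z| <= B) ->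
  `|iter n (step p c) F1 i y - iter n (step p c) F2 i y| <= B.
Proof.
move=> FB; elim: n i y => [//|n IH] i y; rewrite !iterS /step -sumrB.
under eq_bigr do rewrite -mulrBr.
by apply: avg_norm_le => j; apply: IH.
Qed.

Lemma iter_step_tensor_affine n c (phi : R -> R) u (a b : R) i y :
  iter n (step p c) (fun j z => phi z * (a * u j + b)) i y =
  a * iter n (step p c) (fun j z => phi z * u j) i y
  + b * iter n (step p c) (fun j z => phi z) i y.
Proof.
elim: n i y => [|n IH] i y /=; first by ring.
rewrite /step !mulr_sumr -big_split/=.
by apply: eq_bigr => j _; rewrite IH; ring.
Qed.

Lemma iter_step_tensor_norm n c (phi : R -> R) u i y : (forall z, `|phi z| <= 1) ->
  `|iter n (step p c) (fun j z => phi z * u j) i y| <=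
  iter n (avg p) (fun j => `|u j|) i.
Proof.
move=> phi1; elim: n i y => [|n IH] i y /=.
  by rewrite normrM ler_piMl.
rewrite /step; apply: le_trans (ler_norm_sum _ _ _) _.
by apply: ler_sum => j _; rewrite normrM (ger0_norm (p_ge0 _ _)) ler_wpM2l.
Qed.

(** Each step moves the argument of [phi] by at most [kappa], so over a few steps [phi] is nearly
    constant and comes out of the expectation. *)
Lemma iter_step_tensor_near n c (phi : R -> R) u (K kappa : R) i y :
    (forall z a, `|phi (z + a) - phi z| <= K * `|a|) ->
    (forall j, `|u j| <= 1) -> (forall j, `|c j| <= kappa) -> 0 <= K ->
  `|iter n (step p c) (fun j z => phi z * u j) i y - phi y * iter n (avg p) u i|
    <= n%:R * (K * kappa).
Proof.
move=> phiK u1 ck K0; elim: n i y => [|n IH] i y /=; first by rewrite subrr normr0 mul0r.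
rewrite /step {2}/avg mulr_sumr -sumrB.
under eq_bigr do rewrite mulrCA -mulrBr.
apply: avg_norm_le => j.
set A := iter n (step p c) _ _ _; set Q := iter n (avg p) u j.
rewrite (_ : A - phi y * Q = (A - phi (y + c i) * Q) + (phi (y + c i) - phi y) * Q); last by ring.
apply: le_trans (ler_normD _ _) _; rewrite -natr1 [leRHS]mulrDl mul1r.
apply: lerD; first exact: IH.
rewrite normrM -[leRHS]mulr1; apply: ler_pM => //; last exact: iter_avg_norm_le.
by apply: le_trans (phiK _ _) _; rewrite ler_wpM2l.
Qed.

Section AsymptoticIndependence.
Hypothesis p_col : forall j, \sum_i p i j = 1.

(** Unit column sums make the uniform measure invariant. *)
Lemma sum_iter_avg n u : \sum_i iter n (avg p) u i = \sum_i u i.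
Proof.
elim: n => [//|n IH]; rewrite -IH; under eq_bigr do rewrite iterS.
rewrite /avg exchange_big/=; apply: eq_bigr => j _.
by rewrite -mulr_suml p_col mul1r.
Qed.

Let energy u n := \sum_i iter n (avg p) u i ^+ 2.

(** The variance of u(w_(n+1)) for the chain started at w_1 = i. *)
Let variance n u i := iter n (avg p) (fun j => (u j - iter n (avg p) u i) ^+ 2) i.

Lemma iter_avg_varianceE n u i :
  iter n (avg p) (fun j => (u j - iter n (avg p) u i) ^+ 2) i =
  iter n (avg p) (fun j => u j ^+ 2) i - iter n (avg p) u i ^+ 2.
Proof.
set a := iter n (avg p) u i.
transitivity (iter n (avg p)
  (fun j => 1 * u j ^+ 2 + 1 * ((- 2 * a) * u j + a ^+ 2 * 1)) i).
  by congr (iter n _ _ i); apply/funext => j; ring.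
by rewrite !iter_avg_affine iter_avg_cst -/a; ring.
Qed.

Let variance_ge0 n u i : 0 <= variance n u i.
Proof.
rewrite /variance -[leLHS](iter_avg_cst n 0 i); apply: iter_avg_le => j.
exact: sqr_ge0.
Qed.

(** By invariance of the uniform measure the right side is the sum of these variances over all
    starting points. *)
Let variance_le n u i : variance n u i <= \sum_i u i ^+ 2 - energy u n.
Proof.
rewrite -(sum_iter_avg n) /energy -sumrB (bigD1 i)//= -iter_avg_varianceE.
rewrite lerDl sumr_ge0// => j _; rewrite -iter_avg_varianceE; exact: variance_ge0.
Qed.

(** [L] is chosen with its energy within [eta] of the infimum of all energies, below which no later
    energy falls. *)
Lemma energy_cauchy u (eta : R) : 0 < eta ->
  exists L, forall n, \sum_i iter L (avg p) u i ^+ 2 -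
    \sum_i iter (n + L) (avg p) u i ^+ 2 <= eta.
Proof.
move=> eta0; pose S := range (energy u).
have Sinf : has_inf S.
  split; first by exists (energy u 0), 0%N.
  by exists 0 => _ [n _ <-]; apply: sumr_ge0 => i _; apply: sqr_ge0.
have [_ [L _ <-] HL] := inf_adherent eta0 Sinf.
exists L => n; have /ge_inf := Sinf.2 => H.
have : inf S <= energy u (n + L) by apply: H; exists (n + L)%N.
by rewrite /energy in HL *; lra.
Qed.

(* The martingale iter (n - l) avg u (w_l) converges in L^2, uniformly in the
   number of remaining steps, so its last L steps can be frozen; no spectral
   information (and no aperiodicity) is needed. *)
Lemma iter_step_decouple (phi : R -> R) u (K eta : R) :
    (forall z a, `|phi (z + a) - phi z| <= K * `|a|) -> (forall z, `|phi z| <= 1) ->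
    (forall j, `|u j| <= 1) -> 0 <= K -> 0 < eta ->
  exists L, forall n c kappa i y, (L <= n)%N -> (forall j, `|c j| <= kappa) ->
    `|iter n (step p c) (fun j z => phi z * u j) i y
      - iter n (avg p) u i * iter n (step p c) (fun j z => phi z) i y|
    <= eta + 2 * (L%:R * (K * kappa)).
Proof.
move=> phiK phi1 u1 K0 eta0.
have [L HL] := energy_cauchy u (eta ^+ 2) (exprn_gt0 2 eta0).
exists L => n c kappa i y Ln ck; rewrite -(subnK Ln).
set m := (n - L)%N; rewrite !iterD.
set uL := iter L (avg p) u; set a := iter m (avg p) uL i.
pose F1 := iter L (step p c) (fun j z => phi z * u j).
pose F2 := iter L (step p c) (fun j z => phi z).
have D1 := @iter_step_dist m c F1 (fun j z => phi z * uL j) (L%:R * (K * kappa)) i y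
  (fun j z => iter_step_tensor_near L c phi u K kappa j z phiK u1 ck K0).
have D2 := @iter_step_dist m c F2 (fun j z => phi z) (L%:R * (K * kappa)) i y _.
have {}D2 : `|iter m (step p c) F2 i y - iter m (step p c) (fun j z => phi z) i y|
    <= L%:R * (K * kappa).
  apply: D2 => j z.
  have := iter_step_tensor_near L c phi (fun=> 1) K kappa j z phiK _ ck K0.
  rewrite iter_avg_cst mulr1 normr1 => /(_ (fun=> lexx _)).
  rewrite (_ : (fun (j : 'I_k) z => phi z * 1) = (fun _ z => phi z))//.
  by apply/funext => _; apply/funext => ?; rewrite mulr1.
have a1 : `|a| <= 1 by do 2 apply: iter_avg_norm_le => ?.
pose B := iter m (step p c) (fun j z => phi z * uL j) i y.
pose B1 := iter m (step p c) (fun j z => phi z) i y.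
have main : `|B - a * B1| <= eta.
  have -> : B - a * B1 = iter m (step p c) (fun j z => phi z * (uL j - a)) i y.
    have := iter_step_tensor_affine m c phi uL 1 (- a) i y.
    rewrite mul1r mulNr -/B -/B1 => <-.
    by congr (iter m _ _ i y); apply/funext => j; apply/funext => z; rewrite mul1r.
  apply: le_trans (iter_step_tensor_norm m c phi _ i y phi1) _.
  have Vle := variance_le m uL i; have V0 := variance_ge0 m uL i.
  have {}Vle : variance m uL i <= eta ^+ 2.
    by apply: le_trans Vle _; rewrite /energy /uL -!iterD.
  (* The inequality |t| <= t^2 / (2 eta) + eta / 2 passes from the second moment, at most eta^2, to
     the first moment, at most eta. *)
  apply: (@le_trans _ _ (iter m (avg p)
      (fun j => (2 * eta)^-1 * (uL j - a) ^+ 2 + (eta / 2) * 1) i)).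
    apply: iter_avg_le => j; rewrite mulr1.
    have : 0 <= (`|uL j - a| - eta) ^+ 2 / (2 * eta) by rewrite divr_ge0 ?sqr_ge0//; lra.
    rewrite sqrrB -normrX (ger0_norm (sqr_ge0 _)).
    set t := `|_|; set t2 := (uL j - a) ^+ 2.
    have -> : (t2 - t * eta *+ 2 + eta ^+ 2) / (2 * eta) =
       (2 * eta)^-1 * t2 + eta / 2 - t by field; lra.
    lra.
  rewrite iter_avg_affine iter_avg_cst -/(variance m uL i).
  apply: (@le_trans _ _ ((2 * eta)^-1 * eta ^+ 2 + eta / 2 * 1)).
    by rewrite lerD2r ler_wpM2l// invr_ge0; lra.
  by rewrite le_eqVlt; apply/orP; left; apply/eqP; field; lra.
rewrite (_ : _ - _ = (iter m (step p c) F1 i y - B) + (B - a * B1)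
   - a * (iter m (step p c) F2 i y - B1)); last by rewrite -/F1 -/F2; ring.
have aD2 : `|a * (iter m (step p c) F2 i y - B1)| <= L%:R * (K * kappa).
  by rewrite normrM; apply: le_trans D2; rewrite ler_piMl.
apply: le_trans (ler_normB _ _) _.
have := ler_normD (iter m (step p c) F1 i y - B) (B - a * B1).
by rewrite -/B in D1; lra.
Qed.

End AsymptoticIndependence.

Lemma chain_clt g h b (sigma2 s0 : R) :
    (forall i, h i - avg p h i = g i) ->
    (forall i, b i - avg p b i =
       \sum_j p i j * (h j - avg p h i) ^+ 2 - sigma2) ->
    0 <= sigma2 -> 0 < s0 ->
  exists2 C : R, 0 <= C & forall N x i, (0 < N)%N ->
    `|iter N (step p (fun j => g j / Num.sqrt N%:R)) (fun _ y => heat s0 (x - y)) i 0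
      - heat (s0 + sigma2) x| <= C / Num.sqrt N%:R.
Proof.
move=> hg bv sig0 s00; have [K K0 HK] := heat_bounds s0 s00.
have [B B1 HB] : exists2 B : R, 1 <= B & forall i, [/\ `|h i| <= B, `|b i| <= B
    & forall j, `|h j - avg p h i| <= B].
  pose A := \sum_j `|h j|; have hA j : `|h j| <= A.
    by rewrite /A (bigD1 j)//= lerDl sumr_ge0.
  have bA j : `|b j| <= \sum_j `|b j|.
    by rewrite (bigD1 j)//= lerDl sumr_ge0.
  exists (1 + \sum_j `|b j| + A + A); last first.
    move=> i; have A0 : 0 <= A by apply: sumr_ge0.
    have b0 : 0 <= \sum_j `|b j| by apply: sumr_ge0.
    split; [have := hA i; lra | have := bA i; lra | move=> j].
    apply: le_trans (ler_normB _ _) _.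
    have := hA j; have := avg_norm_le A h i hA; rewrite -/(avg p h i); lra.
  have A0 : 0 <= A by apply: sumr_ge0.
  have b0 : 0 <= \sum_j `|b j| by apply: sumr_ge0.
  lra.
(* The four terms come from the remainders [T1], [T2], [T3], [T4] of one step below. *)
pose C1 := K * (B ^+ 3 + B ^+ 2 + sigma2 ^+ 2 + B * sigma2).
have B0 : 0 < B by lra.
have C10 : 0 <= C1.
  by rewrite mulr_ge0 ?(ltW K0)// !addr_ge0 ?mulr_ge0 ?exprn_ge0// ltW.
(* [C1] is the total of N one-step errors; K B + K B is the cost of exchanging [heat] and [W], paid
   once at each end. *)
exists (C1 + 2 * (K * B + K * B)) => [|N x i0 N0].
  by rewrite addr_ge0// mulr_ge0// addr_ge0// mulr_ge0// ltW.
set t := (Num.sqrt N%:R)^-1.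
have rt0 : 0 < Num.sqrt N%:R :> R by rewrite sqrtr_gt0 ltr0n.
have t0 : 0 < t by rewrite invr_gt0.
have t1 : t <= 1.
  by rewrite invf_le1// -[leLHS]sqrtr1 ler_sqrt ?ler1n// ltr0n.
have Nt : N%:R * t ^+ 2 = 1.
  by rewrite /t exprVn sqr_sqrtr ?ler0n// divff// pnatr_eq0 -lt0n.
clearbody t.
(* Subtracting h(i) t turns the steps g(i) t into martingale increments (h(j) - P h(i)) t; the
   b-term of [W] compensates for the dependence of their variance on i. *)
pose z i y := x - y - h i * t.
pose W l i y := heat (s0 + sigma2 * l%:R * t ^+ 2) (z i y)
  + b i * t ^+ 2 / 2 * heat2 (s0 + sigma2 * l%:R * t ^+ 2) (z i y).
have sl l : s0 <= s0 + sigma2 * l%:R * t ^+ 2.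
  by rewrite lerDl mulr_ge0 ?sqr_ge0// mulr_ge0.
have bt i (r : R) (C : R) : `|r| <= C -> `|b i * t ^+ 2 / 2 * r| <= B * t ^+ 2 * C.
  move=> rC; have [_ bB _] := HB i.
  rewrite normrM; apply: ler_pM => //.
  have t20 : 0 <= t ^+ 2 by apply: sqr_ge0.
  rewrite -mulrA normrM (@ger0_norm _ (t ^+ 2 / 2)) ?divr_ge0//.
  apply: (@le_trans _ _ (B * (t ^+ 2 / 2))); first by rewrite ler_wpM2r ?divr_ge0.
  by rewrite (ler_wpM2l (ltW B0))//; lra.
have Wnear l i y : `|W l i y - heat (s0 + sigma2 * l%:R * t ^+ 2) (x - y)| <=
    (K * B + K * B) * t.
  have [hB bB _] := HB i.
  have [_ HK2 _ _ _] := HK _ (x - y) (- (h i * t)) 0 (sl l) (lexx 0).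
  have [HK1 _ _ _ _] := HK _ (z i y) 0 0 (sl l) (lexx 0).
  have := bt i _ _ HK1; rewrite /W.
  set e := b i * _ / 2 * _ => He.
  rewrite addrAC; apply: le_trans (ler_normD _ _) _.
  rewrite mulrDl; apply: lerD.
    apply: le_trans HK2 _; rewrite normrN normrM (gtr0_norm t0).
    by rewrite -mulrA ler_pM2l// ler_pM2r.
  apply: le_trans He _; rewrite (_ : B * t ^+ 2 * K = K * B * t * t); last by ring.
  by rewrite ler_piMr// !mulr_ge0// ltW.
have onestep l i y : `|step p (fun j => g j * t) (W l) i y - W l.+1 i y| <= C1 * t ^+ 3.
  set s := s0 + sigma2 * l%:R * t ^+ 2; pose d := sigma2 * t ^+ 2.
  have d0 : 0 <= d by rewrite mulr_ge0// sqr_ge0.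
  have ss : s0 <= s by apply: sl.
  pose zi := z i y; pose a j := - ((h j - avg p h i) * t).
  pose T1 j := heat s (zi + a j) - heat s zi - a j * heat1 s zi - a j ^+ 2 / 2 * heat2 s zi.
  pose T2 j := b j * t ^+ 2 / 2 * (heat2 s (zi + a j) - heat2 s zi).
  pose T3 := heat (s + d) zi - heat s zi - d / 2 * heat2 s zi.
  pose T4 := b i * t ^+ 2 / 2 * (heat2 (s + d) zi - heat2 s zi).
  (* In the expansion at [zi] the first-order terms average to 0, and the second-order ones cancel
     by v + P b = b + sigma2, with v the conditional variance. *)
  have -> : step p (fun j => g j * t) (W l) i y - W l.+1 i y =
      \sum_j p i j * (T1 j + T2 j) - T3 - T4.
    have -> : W l.+1 i y = heat (s + d) zi + b i * t ^+ 2 / 2 * heat2 (s + d) zi.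
      rewrite /W -/zi; have -> : s0 + sigma2 * l.+1%:R * t ^+ 2 = s + d => //.
      by rewrite /s /d -natr1; ring.
    have -> : step p (fun j => g j * t) (W l) i y = \sum_j (p i j * (T1 j + T2 j)
        + (heat s zi * p i j - t * heat1 s zi * (p i j * h j - avg p h i * p i j)
        + t ^+ 2 / 2 * heat2 s zi * (p i j * (h j - avg p h i) ^+ 2)
        + t ^+ 2 / 2 * heat2 s zi * (p i j * b j))).
      apply: eq_bigr => j _; rewrite /W -/s.
      have -> : z j (y + g i * t) = zi + a j.
        by rewrite /zi /z /a -hg; ring.
      by rewrite /T1 /T2 /a; field.
    rewrite !big_split/= sumrN -!mulr_sumr sumrB -!mulr_sumr p_row.
    rewrite -/(avg p h i) -/(avg p b i).
    have := bv i; set v := \sum_j _ => bvi.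
    have -> : avg p b i = b i - v + sigma2 by rewrite -[v](subrK sigma2) -bvi; ring.
    by rewrite /T3 /T4 /d; field.
  have [_ bB hB] := HB i.
  have HT1 j : `|T1 j| <= K * B ^+ 3 * t ^+ 3.
    have [_ _ + _ _] := HK s zi (a j) 0 ss (lexx 0) => H.
    apply: le_trans H _; rewrite -mulrA ler_pM2l// -exprMn lerXn2r ?nnegrE//.
      by rewrite mulr_ge0// ltW.
    by rewrite normrN normrM (gtr0_norm t0) ler_pM2r.
  have HT2 j : `|T2 j| <= K * B ^+ 2 * t ^+ 3.
    have [_ _ _ H _] := HK s zi (a j) 0 ss (lexx 0).
    have {}H : `|heat2 s (zi + a j) - heat2 s zi| <= K * (B * t).
      apply: le_trans H _; rewrite ler_pM2l// normrN normrM (gtr0_norm t0).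
      by rewrite ler_pM2r.
    apply: le_trans (bt j _ _ H) _; rewrite le_eqVlt; apply/orP; left; apply/eqP; ring.
  have [_ _ _ _ [H3 H4]] := HK s zi 0 d ss d0.
  have t4 : t ^+ 4 <= t ^+ 3 by rewrite exprS ler_piMl// exprn_ge0// ltW.
  have HT3 : `|T3| <= K * sigma2 ^+ 2 * t ^+ 3.
    apply: le_trans H3 _; rewrite -mulrA ler_pM2l// /d exprMn ler_wpM2l ?sqr_ge0//.
    by rewrite -exprM.
  have HT4 : `|T4| <= K * (B * sigma2) * t ^+ 3.
    apply: le_trans (bt i _ _ H4) _.
    rewrite (_ : B * t ^+ 2 * (K * d) = K * (B * sigma2) * t ^+ 4); last by rewrite /d; ring.
    by rewrite ler_wpM2l// !mulr_ge0// ltW.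
  have HT12 : `|\sum_j p i j * (T1 j + T2 j)| <= K * B ^+ 3 * t ^+ 3 + K * B ^+ 2 * t ^+ 3.
    by apply: avg_norm_le => j; apply: le_trans (ler_normD _ _) _; apply: lerD.
  apply: le_trans (ler_normB _ _) _.
  have := ler_normB (\sum_j p i j * (T1 j + T2 j)) T3.
  rewrite /C1 !mulrDr !mulrDl; lra.
(* One-step errors add up because averaging does not increase the supremum norm. *)
have total l i y : `|iter l (step p (fun j => g j * t)) (W 0%N) i y - W l i y|
    <= l%:R * (C1 * t ^+ 3).
  elim: l i y => [|l IH] i y; first by rewrite subrr normr0 mul0r.
  rewrite iterS -natr1 mulrDl mul1r -[_ - _](subrKA (step p (fun j => g j * t) (W l) i y)).
  apply: le_trans (ler_normD _ _) _; apply: lerD; last exact: onestep.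
  rewrite /step -sumrB; under eq_bigr do rewrite -mulrBr.
  by apply: avg_norm_le => j; apply: IH.
have E0 : `|iter N (step p (fun j => g j * t)) (fun _ y => heat s0 (x - y)) i0 0
     - iter N (step p (fun j => g j * t)) (W 0%N) i0 0| <= (K * B + K * B) * t.
  apply: iter_step_dist => j y; rewrite distrC.
  by have := Wnear 0%N j y; rewrite mulr0 mul0r addr0.
have EN := Wnear N i0 0.
(* With all N steps remaining the variance is s0 + sigma2, since N t^2 = 1. *)
rewrite subr0 -mulrA Nt mulr1 in EN.
have := total N i0 0.
rewrite (_ : N%:R * (C1 * t ^+ 3) = C1 * t * (N%:R * t ^+ 2)); last by ring.
rewrite Nt mulr1 => ET.
set X1 := iter N _ _ _ _ in E0 *; set X2 := iter N _ _ _ _ in E0 ET.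
have -> : X1 - heat (s0 + sigma2) x =
  (X1 - X2) + (X2 - W N i0 0) + (W N i0 0 - heat (s0 + sigma2) x) by ring.
apply: le_trans (ler_normD _ _) _.
have := ler_normD (X1 - X2) (X2 - W N i0 0); lra.
Qed.

End Chain.

(** * n-step transition probabilities, irreducibility and return probabilities *)

Definition pn {R : realType} {k : nat} (p : 'I_k -> 'I_k -> R) (n : nat) (i j : 'I_k) : R :=
  iter n (avg p) (fun l => (l == j)%:R) i.

Section TransitionProbability.
Context {R : realType} {k : nat}.
Variable p : 'I_k -> 'I_k -> R.
Hypothesis p_ge0 : forall i j, 0 <= p i j.
Hypothesis p_row : forall i, \sum_j p i j = 1.

Lemma iter_avgE n (u : 'I_k -> R) i : iter n (avg p) u i = \sum_j pn p n i j * u j.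
Proof.
elim: n i => [|n IH] i.
  rewrite (bigD1 i)//= big1 /pn /= ?eqxx ?mul1r ?addr0// => j ji.
  by rewrite eq_sym (negPf ji) mul0r.
rewrite iterS {1}/avg; under eq_bigr do rewrite IH mulr_sumr.
rewrite exchange_big/=; apply: eq_bigr => j _.
transitivity ((\sum_l p i l * pn p n l j) * u j); last by [].
rewrite mulr_suml.
by apply: eq_bigr => l _; rewrite mulrA.
Qed.

Lemma pnD m n i j : pn p (m + n) i j = \sum_l pn p m i l * pn p n l j.
Proof. by rewrite /pn iterD iter_avgE. Qed.

Lemma pn1 i j : pn p 1 i j = p i j.
Proof.
rewrite /pn /= /avg (bigD1 j)//= eqxx mulr1 big1 ?addr0// => l lj.
by rewrite (negPf lj) mulr0.
Qed.

Lemma pn_ge0 n i j : 0 <= pn p n i j.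
Proof.
rewrite -[leLHS](iter_avg_cst p p_row n 0 i); apply: (iter_avg_le p p_ge0) => l.
exact: ler0n.
Qed.

Lemma pn_gt0D m n i l j : 0 < pn p m i l -> 0 < pn p n l j -> 0 < pn p (m + n) i j.
Proof.
move=> il lj; rewrite pnD (bigD1 l)//=; apply: ltr_wpDr; last exact: mulr_gt0.
by apply: sumr_ge0 => x _; rewrite mulr_ge0 ?pn_ge0.
Qed.

Lemma pn_gt0_mul n m i : 0 < pn p n i i -> 0 < pn p (m * n) i i.
Proof.
move=> Hn; elim: m => [|m IH]; first by rewrite mul0n /pn /= eqxx.
by rewrite mulSn; apply: pn_gt0D IH.
Qed.

(** By invariance of the uniform measure the Dirichlet form of a harmonic function is the sum of
    P(h^2) - h^2, which is 0. So [h] agrees across every edge, and connectedness concludes. *)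
Lemma harmonic_cst (p_conn : forall i j, connect [rel x y | (0 < p x y) || (0 < p y x)] i j)
    (p_col : forall j, \sum_i p i j = 1) (h : 'I_k -> R) :
  (forall i, avg p h i = h i) -> forall i j, h i = h j.
Proof.
move=> hh i j.
have dirichlet : \sum_x \sum_y p x y * (h y - h x) ^+ 2 = 0.
  transitivity (\sum_x (avg p (fun y => h y ^+ 2) x - h x ^+ 2)).
    apply: eq_bigr => x _; have := iter_avg_varianceE p p_row 1 h x.
    by rewrite /= hh.
  by rewrite sumrB (sum_iter_avg p p_col 1) subrr.
have edge x y : 0 < p x y -> h y = h x.
  move=> pxy; have sq0 x' : 0 <= \sum_y p x' y * (h y - h x') ^+ 2.
    by apply: sumr_ge0 => y' _; rewrite mulr_ge0 ?sqr_ge0.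
  have Ex := psumr_eq0P (fun x _ => sq0 x) dirichlet (i := x) isT.
  have sq0' y' : 0 <= p x y' * (h y' - h x) ^+ 2 by rewrite mulr_ge0 ?sqr_ge0.
  have /eqP := psumr_eq0P (fun y _ => sq0' y) Ex (i := y) isT.
  by rewrite mulf_eq0 gt_eqF//= sqrf_eq0 subr_eq0 => /eqP.
have cl : fingraph.closed [rel x y | (0 < p x y) || (0 < p y x)] [pred x | h x == h i].
  by move=> x y /orP[] /edge; rewrite !inE => ->.
by have := closed_connect cl (p_conn i j); rewrite !inE eqxx => /esym/eqP ->.
Qed.

Section DoublyStochastic.
Hypothesis p_col : forall j, \sum_i p i j = 1.

Lemma pn_col n j : \sum_i pn p n i j = 1.
Proof.
rewrite /pn (sum_iter_avg p p_col) (bigD1 j)//= eqxx big1 ?addr0// => i ij.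
by rewrite (negPf ij).
Qed.

Hypothesis p_conn : forall i j, connect [rel x y | (0 < p x y) || (0 < p y x)] i j.

(* The mass entering an out-closed set equals the mass leaving it, which is 0;
   so out-closed sets are also in-closed. *)
Lemma strongly_connected i j : exists n, 0 < pn p n i j.
Proof.
pose S : pred 'I_k := fun x => `[< exists n, 0 < pn p n i x >].
have Sout x y : S x -> 0 < p x y -> S y.
  move=> /asboolP[n Hn] pxy; apply/asboolP; exists (n + 1)%N.
  by apply: (pn_gt0D _ _ _ x) => //; rewrite pn1.
have p0 x y : S x -> ~~ S y -> p x y = 0.
  move=> Sx Sy; apply/eqP; rewrite eq_le p_ge0 andbT leNgt.
  by apply: contra Sy => /(Sout _ _ Sx).
have E1 : \sum_(x | S x) \sum_(y | S y) p x y = \sum_(x | S x) 1.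
  apply: eq_bigr => x Sx; rewrite -(p_row x) [RHS](bigID S)/=.
  by rewrite [X in _ + X]big1 ?addr0// => y Sy; apply: p0.
have E2 : \sum_(y | S y) \sum_(x | ~~ S x) p x y = 0.
  have : \sum_(y | S y) \sum_x p x y = \sum_(y | S y) 1 by apply: eq_bigr.
  under eq_bigr do rewrite (bigID S)/=.
  by rewrite big_split/= exchange_big/= E1 => /(canRL (addKr _)); rewrite addNr.
have Sin x y : S y -> 0 < p x y -> S x.
  move=> Sy; apply: contraTT => Sx.
  have H0 y' : S y' -> 0 <= \sum_(x | ~~ S x) p x y' by move=> _; apply: sumr_ge0.
  have Ey := psumr_eq0P H0 E2 Sy.
  by rewrite (psumr_eq0P (fun x _ => p_ge0 x y) Ey Sx) ltxx.
have cl : fingraph.closed [rel x y | (0 < p x y) || (0 < p y x)] S.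
  move=> x y /orP[] H; rewrite -!topredE/=; apply/idP/idP.
  - by move=> Sx; apply: Sout H.
  - by move=> Sy; apply: Sin H.
  - by move=> Sx; apply: Sin H.
  - by move=> Sy; apply: Sout H.
have /asboolP// : S j.
have := closed_connect cl (p_conn i j); rewrite -!topredE/= => <-.
by apply/asboolP; exists 0%N; rewrite /pn /= eqxx.
Qed.

Lemma exists_cycle (i : 'I_k) : exists2 n, (0 < n)%N & 0 < pn p n i i.
Proof.
have [j ij] : exists j, 0 < p i j.
  apply/not_existsP => H; have := p_row i; rewrite big1 => [/eqP|j _].
    by rewrite eq_sym oner_eq0.
  by apply/eqP; rewrite eq_le p_ge0 andbT leNgt; apply/negP/H.
have [n Hn] := strongly_connected j i.
by exists (1 + n)%N => //; apply: pn_gt0D Hn; rewrite pn1.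
Qed.

Let pattern n : {set 'I_k * 'I_k} := [set ij | 0 < pn p n ij.1 ij.2]%SET.

Let patternS m n : pattern m = pattern n -> pattern m.+1 = pattern n.+1.
Proof.
move=> mn; apply/setP => -[i j]; rewrite !inE/=.
have E l : (0 < pn p m l j) = (0 < pn p n l j).
  by have /setP/(_ (l, j)) := mn; rewrite !inE.
have half m' n' : (forall l, (0 < pn p m' l j) = (0 < pn p n' l j)) ->
    0 < pn p m'.+1 i j -> 0 < pn p n'.+1 i j.
  move=> E'; rewrite -add1n pnD => H.
  have [l Hl] : exists l, 0 < pn p 1 i l * pn p m' l j.
    apply/not_existsP => N; move: H; rewrite big1 ?ltxx// => l _.
    apply/eqP; rewrite eq_le mulr_ge0 ?pn_ge0// andbT leNgt; exact/negP/N.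
  have pl : 0 < pn p m' l j.
    rewrite lt_def pn_ge0 andbT; apply: contraTneq Hl => ->.
    by rewrite mulr0 ltxx.
  have pl1 : 0 < pn p 1 i l by rewrite pmulr_lgt0 in Hl.
  by rewrite -add1n; apply: pn_gt0D pl1 _; rewrite -E'.
by apply/idP/idP; apply: half.
Qed.

(** There are finitely many zero patterns, so two powers share one; since each pattern determines
    the next, the coincidence propagates. *)
Let pattern_periodic : exists a t, (0 < t)%N /\
  forall n m, (a <= n)%N -> pattern (n + t * m) = pattern n.
Proof.
pose T := {set 'I_k * 'I_k}.
have : ~~ injectiveb (fun n : 'I_(#|T|.+1) => pattern n).
  by apply/negP => /injectiveP/leq_card; rewrite card_ord ltnn.
move=> /injectivePn[a [b ab E]].
wlog lt_ab : a b ab E / (a < b)%N.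
  move=> H; have [/H|/H|] := ltngtP a b; first exact.
    by apply => //; rewrite eq_sym.
  by move=> /val_inj/eqP; rewrite (negPf ab).
exists a, (b - a)%N; split; first by rewrite subn_gt0.
have per n : (a <= n)%N -> pattern (n + (b - a)) = pattern n.
  move=> /subnK <-; elim: (n - a)%N => [|m IH].
    by rewrite add0n subnKC ?(ltnW lt_ab).
  by rewrite !addSn; apply: patternS.
move=> n m an; elim: m => [|m IH]; first by rewrite muln0 addn0.
by rewrite mulnS addnCA addnC per// (leq_trans an)// leq_addr.
Qed.

(** A return of length n is split as i -> x in a fixed number [s] of steps, then x -> i. The column
    sum provides an [x] for which the second factor is at least 1/(k+1); the first is at least the
    smallest positive entry of P^s. *)
Lemma pn_lower_bound : exists2 c : R, 0 < c &
  exists N0, forall n i, (N0 <= n)%N -> 0 < pn p n i i -> c <= pn p n i i.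
Proof.
have [a [t [t0 per]]] := pattern_periodic.
(* A multiple of the period, not below [a]: removing [s] steps preserves the pattern. *)
pose s := (t * a)%N.
pose c0 := \big[Num.min/1]_(x : 'I_k * 'I_k | 0 < pn p s x.1 x.2) pn p s x.1 x.2.
have c00 : 0 < c0 by apply: lt_bigmin.
have c0E x y : 0 < pn p s x y -> c0 <= pn p s x y.
  exact: (@bigmin_le_cond _ _ _ _ (x, y)).
exists (c0 / k.+1%:R); first by rewrite divr_gt0.
exists (a + s)%N => n i n0 Hn.
have sn : (s <= n)%N by apply: leq_trans n0; rewrite leq_addl.
have asn : (a <= n - s)%N by rewrite leq_subRL// addnC.
have an : (a <= n)%N by apply: leq_trans n0; rewrite leq_addr.
(* If all k entries were below 1/(k+1), the column sum would be at most k/(k+1) < 1. *)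
have [x Hx] : exists x, k.+1%:R^-1 <= pn p (n - s) x i.
  apply/not_existsP => H; have := pn_col (n - s) i; apply/eqP; rewrite lt_eqF//.
  apply: (@le_lt_trans _ _ (\sum_(x < k) k.+1%:R^-1)).
    by apply: ler_sum => x _; apply: ltW; rewrite ltNge; apply/negP/H.
  rewrite sumr_const card_ord -[_ *+ k]mulr_natl.
  by rewrite ltr_pdivrMr// mul1r ltr_nat.
have xi : 0 < pn p n x i.
  have : (x, i) \in pattern (n - s) by rewrite inE; apply: lt_le_trans Hx; rewrite invr_gt0.
  by rewrite -(per _ a asn) subnK// inE.
have [l Hl] := strongly_connected i x.
(* A walk i -> i -> x of length n + l, followed by t - 1 loops at [x] of that length, has length t
   (n + l), where the pattern is that of s = t a. *)
have ix : 0 < pn p s i x.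
  have xx : 0 < pn p (n + l) x x by apply: pn_gt0D xi Hl.
  have H : 0 < pn p (n + l + t.-1 * (n + l)) i x.
    by apply: (pn_gt0D _ _ _ x); [apply: pn_gt0D Hn Hl | apply: pn_gt0_mul].
  have : (i, x) \in pattern (t * (n + l)) by rewrite inE -[X in pn p (X * _)](prednK t0) mulSn.
  have lea : (a <= n + l)%N by rewrite (leq_trans an)// leq_addr.
  have sa : (a <= s)%N by rewrite /s -[leqLHS]mul1n leq_mul2r t0 orbT.
  by rewrite -(subnKC lea) mulnDr per// inE.
rewrite -(subnKC sn) pnD (bigD1 x)//=.
apply: ler_wpDr; first by apply: sumr_ge0 => y _; rewrite mulr_ge0 ?pn_ge0.
by apply: ler_pM => //; [exact: ltW | exact: c0E].
Qed.

End DoublyStochastic.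

Lemma pn_sym (p_sym : forall i j, p i j = p j i) n i j : pn p n i j = pn p n j i.
Proof.
elim: n i j => [|n IH] i j; first by rewrite /pn /= eq_sym.
rewrite -[in LHS]add1n -[in RHS]addn1 !pnD; apply: eq_bigr => l _.
by rewrite !pn1 p_sym IH mulrC.
Qed.

End TransitionProbability.

(** * Closed walks and the transfer operator *)

Definition trans (R : realType) {k : nat} (G : digraph k) (r : nat) (i j : 'I_k) : R :=
  (mult G i j)%:R / r%:R.

(** Keeping both endpoints as parameters permits recursion on the first arc, which [cycle] does
    not. *)
Fixpoint walk {k : nat} {G : digraph k} (i : 'I_k) (w : seq (edge G)) (j : 'I_k) : bool :=
  if w is e :: w' then (source e == i) && walk (target e) w' j else i == j.

Section Walks.
Context {R : realType} {k : nat}.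
Variables (G : digraph k) (r : nat).
Hypothesis G_regular : regular G r.
Hypothesis r_gt0 : (0 < r)%N.

Local Notation p := (trans R G r).

Lemma trans_ge0 i j : 0 <= p i j.
Proof. by rewrite divr_ge0. Qed.

Lemma trans_gt0 i j : (0 < p i j) = (0 < mult G i j)%N.
Proof. by rewrite /trans pmulr_lgt0 ?ltr0n// invr_gt0 ltr0n. Qed.

Lemma trans_row i : \sum_j p i j = 1.
Proof.
rewrite -mulr_suml -natr_sum; have [-> _] := G_regular.
by rewrite divff// pnatr_eq0 -lt0n.
Qed.

Lemma trans_col j : \sum_i p i j = 1.
Proof.
rewrite -mulr_suml -natr_sum; have [_ ->] := G_regular.
by rewrite divff// pnatr_eq0 -lt0n.
Qed.

Lemma cycle_walk (e : edge G) w :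
  cycle [rel e e' | target e == source e'] (e :: w) = walk (target e) w (source e).
Proof.
rewrite /=; elim: w {1 3}e => [|e1 w IH] e0 /=; first by rewrite andbT.
by rewrite IH [target e0 == _]eq_sym.
Qed.

(** Each closed walk is counted at its basepoint, the source of its first arc. *)
Lemma sum_closed_walks N (F : N.-tuple (edge G) -> R) : (0 < N)%N ->
  \sum_(w in closed_walks G N) F w = \sum_i \sum_(w : N.-tuple (edge G) | walk i w i) F w.
Proof.
case: N F => // N F _.
under [RHS]eq_bigr do rewrite big_mkcond.
rewrite exchange_big/= big_mkcond; apply: eq_bigr => w _.
case/tupleP: w => e w; rewrite inE cycle_walk -big_mkcond/= big_mkcondr/=.
by rewrite (big_pred1 (source e)) // => i; rewrite eq_sym.
Qed.

Lemma step_trans (F : 'I_k -> R -> R) (c : 'I_k -> R) i y :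
  r%:R * step p c F i y = \sum_(e : edge G | source e == i) F (target e) (y + c i).
Proof.
rewrite /step mulr_sumr (partition_big (@target _ G) xpredT)//=.
apply: eq_bigr => j _.
rewrite (eq_bigr (fun=> F j (y + c i))) => [|e /andP[_ /eqP->]//].
rewrite sumr_const mulrA /trans mulrCA divff ?pnatr_eq0 -?lt0n// mulr1 mulr_natl.
by [].
Qed.

(** A walk of the chain is a sequence of uniform choices among [r] outgoing arcs, so counting walks
    is r^N times an expectation. *)
Lemma sum_walks N (phi : R -> R) (c : 'I_k -> R) i j y :
  \sum_(w : N.-tuple (edge G) | walk i w j) phi (y + \sum_(e <- w) c (source e)) =
  r%:R ^+ N * iter N (step p c) (fun l z => phi z * (l == j)%:R) i y.
Proof.
elim: N i y => [|N IH] i y.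
  rewrite expr0 mul1r /= big_mkcond (big_pred1 [tuple]) => [|w]; last by apply/esym/eqP; exact: tuple0.
  by rewrite big_nil addr0 /=; case: (i == j); rewrite ?mulr1 ?mulr0.
rewrite iterS exprSr -mulrA step_trans mulr_sumr.
rewrite (reindex (fun ew : edge G * N.-tuple (edge G) => [tuple of ew.1 :: ew.2]))/=; last first.
  exists (fun w => (thead w, [tuple of behead w])) => [[e w] _|w _] /=.
    by rewrite theadE; congr pair; apply: val_inj.
  by rewrite -tuple_eta.
rewrite -(pair_big_dep (fun e => source e == i) (fun e (w : N.-tuple (edge G)) => walk (target e) w j)
  (fun e w => phi (y + \sum_(e' <- e :: w) c (source e'))))/=.
apply: eq_bigr => e /eqP <-; rewrite -IH; apply: eq_bigr => w _.
by rewrite big_cons addrA.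
Qed.

Lemma iter_step_const n (c u : 'I_k -> R) i y :
  iter n (step p c) (fun l _ => u l) i y = iter n (avg p) u i.
Proof.
elim: n i y => [//|n IH] i y; rewrite !iterS /step {2}/avg.
by apply: eq_bigr => j _; rewrite IH.
Qed.

Lemma sum_closed_walksE N (phi : R -> R) (c : 'I_k -> R) : (0 < N)%N ->
  \sum_(w in closed_walks G N) phi (\sum_(l < N) c (source (tnth w l))) =
  r%:R ^+ N * \sum_i iter N (step p c) (fun l z => phi z * (l == i)%:R) i 0.
Proof.
move=> N0; rewrite sum_closed_walks// mulr_sumr; apply: eq_bigr => i _.
rewrite -sum_walks; apply: eq_bigr => w _.
by rewrite add0r big_tuple.
Qed.

Lemma card_closed_walks N : (0 < N)%N ->
  #|closed_walks G N|%:R = r%:R ^+ N * \sum_i pn p N i i :> R.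
Proof.
move=> N0; have := sum_closed_walksE N (fun=> 1) (fun=> 0) N0.
rewrite sumr_const => ->; congr (_ * _); apply: eq_bigr => i _.
rewrite /pn -(iter_step_const N (fun=> 0) _ i 0).
by congr (iter N _ _ i 0); apply/funext => l; apply/funext => z; rewrite mul1r.
Qed.

Lemma closed_walks_gt0 N : (0 < N)%N ->
  (0 < #|closed_walks G N|)%N <-> exists i, 0 < pn p N i i.
Proof.
move=> N0; rewrite -(ltr0n R) card_closed_walks//.
rewrite pmulr_rgt0 ?exprn_gt0 ?ltr0n//.
have pge i : 0 <= pn p N i i by apply: (pn_ge0 p trans_ge0 trans_row).
split=> [H|[i Hi]]; last first.
  by rewrite (bigD1 i)//=; apply: ltr_wpDr => //; apply: sumr_ge0.
apply/not_existsP => Np; move: H; rewrite big1 ?ltxx// => i _.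
by apply/eqP; rewrite eq_le pge andbT leNgt; apply/negP/Np.
Qed.

Hypothesis G_connected : connected_graph G.

Lemma trans_connected i j : connect [rel x y | (0 < p x y) || (0 < p y x)] i j.
Proof.
rewrite (eq_connect (e' := [rel x y | (0 < mult G x y)%N || (0 < mult G y x)%N])) => [|x y].
  exact: G_connected.
by rewrite /= !trans_gt0.
Qed.

Lemma infinitely_many_closed_walks (i : 'I_k) :
  infinite_set [set N : nat | (0 < #|closed_walks G N|)%N].
Proof.
have [n n0 Hn] := exists_cycle p trans_ge0 trans_row trans_col trans_connected i.
move=> /finite_seqP[s sE].
(* Chosen so that m n exceeds every element of the finite list [s]. *)
pose m := (\sum_(x <- s) x)%N.+1.
have : (m * n)%N \in s.
  have : [set` s] (m * n)%N.
    rewrite -sE /=; apply/closed_walks_gt0; first by rewrite muln_gt0 n0.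
    exists i; exact: (pn_gt0_mul p trans_ge0 trans_row).
  by [].
move=> ms; have : (m * n <= \sum_(x <- s) x)%N by rewrite (big_rem _ ms)/= leq_addr.
by rewrite leqNgt; apply/negP/negPn; rewrite leq_pmulr.
Qed.

(** Without an odd closed walk at [i], reachability from [i] in evenly many steps would be a
    2-colouring. An odd closed walk, prolonged by going back and forth along an edge, gives all
    large odd lengths; the even ones need only the edge. *)
Lemma undirected_closed_walks (i : 'I_k) : undirected G -> ~ bipartite G ->
  \forall N \near \oo, (0 < #|closed_walks G N|)%N.
Proof.
move=> und nbip.
have sym x y : p x y = p y x by rewrite /trans und.
have psym := pn_sym p sym.
have gt0D := pn_gt0D p trans_ge0 trans_row.
have [m [om Hm]] : exists m, odd m /\ 0 < pn p m i i.
  apply: contrapT => Nodd; apply: nbip.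
  exists (fun x => `[< exists n, ~~ odd n /\ 0 < pn p n i x >]) => e.
  have pe : 0 < pn p 1 (source e) (target e).
    rewrite (pn1 p) trans_gt0; apply/card_gt0P; exists e.
    by rewrite inE !eqxx.
  case: asboolP => [[n [en Hn]]|Nx]; case: asboolP => [[n' [en' Hn']]|Ny]//; exfalso.
    apply: Nodd; exists (n + 1 + n')%N; split.
      by rewrite !oddD (negPf en) (negPf en').
    by apply: (gt0D _ _ _ (target e)); [apply: gt0D Hn pe | rewrite psym].
  have [l Hl] := strongly_connected p trans_ge0 trans_row trans_col trans_connected i (source e).
  have ol : odd l by apply: contrapT => /negP el; apply: Nx; exists l.
  by apply: Ny; exists (l + 1)%N; split; [rewrite oddD ol | apply: gt0D Hl pe].
have [j ij] : exists j, 0 < pn p 1 i j.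
  have [l l0 Hl] := exists_cycle p trans_ge0 trans_row trans_col trans_connected i.
  case: l l0 Hl => // l _; rewrite -add1n.
  move=> H; apply/not_existsP => N; move: H; rewrite pnD big1 ?ltxx// => x _.
  have := N x; rewrite lt_def.
  have := pn_ge0 p trans_ge0 trans_row 1 i x => -> /negP; rewrite andbT negbK => /eqP ->.
  by rewrite mul0r.
have two : 0 < pn p 2 i i by apply: (gt0D 1%N 1%N _ j) => //; rewrite psym.
exists m.+1 => //= N mN; apply/closed_walks_gt0; first exact: leq_trans mN.
exists i; case oN : (odd N); last first.
  rewrite -(odd_double_half N) oN add0n -muln2.
  exact: (pn_gt0_mul p trans_ge0 trans_row).
rewrite -(subnKC (ltnW mN)); apply: gt0D Hm _.
rewrite -(odd_double_half (N - m)) oddB ?(ltnW mN)// oN om add0n -muln2.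
exact: (pn_gt0_mul p trans_ge0 trans_row).
Qed.

End Walks.

(** * The Laplacian and the variance *)

Section Laplacian.
Context {R : realType} {k : nat}.
Variables (G : digraph k) (r : nat).
Hypothesis G_regular : regular G r.
Hypothesis r_gt0 : (0 < r)%N.
Hypothesis k_gt0 : (0 < k)%N.

Local Notation p := (trans R G r).
Local Notation H0 := (zero_sum R k).

Lemma mem_zero_sum (v : 'cV[R]_k) : (v \in H0) = (\sum_i v i 0 == 0).
Proof.
rewrite memv_ker lfunE/=.
have -> : const_mx 1 *m v = (\sum_i v i 0)%:M :> 'cV[R]_1.
  apply/matrixP => i j; rewrite !ord1 !mxE eqxx mulr1n.
  by apply: eq_bigr => l _; rewrite mxE mul1r.
by apply/eqP/eqP => [/matrixP/(_ 0 0)|->]; [rewrite !mxE mulr1n | apply: raddf0].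
Qed.

Lemma laplacianE (v : 'cV[R]_k) i :
  (laplacian R G r *m v) i 0 = r%:R * (v i 0 - avg p (fun j => v j 0) i).
Proof.
have rn0 : r%:R != 0 :> R by rewrite pnatr_eq0 -lt0n.
rewrite mulmxBl mul_scalar_mx !mxE mulrBr; congr (_ - _).
rewrite /avg mulr_sumr; apply: eq_bigr => j _; rewrite mxE /trans mulrA.
by rewrite [r%:R * _]mulrC divfK.
Qed.

Lemma val_laplacian0 (u : subvs_of H0) :
  vsval (laplacian0 R G r u) = laplacian R G r *m vsval u.
Proof.
rewrite /laplacian0 !comp_lfunE !lfunE/= vsprojK// mem_zero_sum.
under eq_bigr do rewrite laplacianE.
rewrite -mulr_sumr sumrB (sum_iter_avg p (trans_col G r G_regular r_gt0) 1).
by rewrite subrr mulr0.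
Qed.

(** Since Delta = r (I - P), its kernel consists of harmonic functions, which are constant; a
    constant with zero sum vanishes. *)
Lemma laplacian0_inj (G_connected : connected_graph G) : lker (laplacian0 R G r) == 0%VS.
Proof.
have rn0 : r%:R != 0 :> R by rewrite pnatr_eq0 -lt0n.
apply/lker0P; suff ker u : laplacian0 R G r u = 0 -> u = 0.
  by move=> u v uv; apply/eqP; rewrite -subr_eq0; apply/eqP/ker; rewrite linearB/= uv subrr.
move=> /(congr1 vsval); rewrite val_laplacian0 => Lu.
have harm i : avg p (fun j => vsval u j 0) i = vsval u i 0.
  have := laplacianE (vsval u) i; rewrite Lu linear0 mxE => /esym/eqP.
  by rewrite mulf_eq0 (negPf rn0)/= subr_eq0 => /eqP.
have cst := harmonic_cst p (trans_ge0 G r) (trans_row G r G_regular r_gt0)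
  (trans_connected G r r_gt0 G_connected) (trans_col G r G_regular r_gt0) _ harm.
apply: val_inj; rewrite linear0; apply/matrixP => i j; rewrite ord1 mxE.
have := subvsP u; rewrite mem_zero_sum.
rewrite (eq_bigr (fun=> vsval u i 0)) => [|l _]; last exact: cst.
by rewrite sumr_const card_ord mulrn_eq0 -[k == 0%N]negbK -lt0n k_gt0 => /eqP.
Qed.

Hypothesis G_connected : connected_graph G.

Lemma poisson_equation (v : 'cV[R]_k) : v \in H0 ->
  let h i := r%:R * vsval ((laplacian0 R G r)^-1%VF (vsproj H0 v)) i 0 in
  forall i, h i - avg p h i = v i 0.
Proof.
move=> vH h i; pose u := (laplacian0 R G r)^-1%VF (vsproj H0 v).
have /(congr1 vsval) := lker0_lfunVK (laplacian0_inj G_connected) (vsproj H0 v).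
rewrite val_laplacian0 vsprojK// => <-; rewrite laplacianE mulrBr; congr (_ - _).
by rewrite /avg mulr_sumr; apply: eq_bigr => j _; rewrite /h mulrCA.
Qed.

Lemma centered_zero_sum (f : 'I_k -> R) : centered f \in H0.
Proof.
rewrite mem_zero_sum; under eq_bigr do rewrite mxE.
rewrite sumrB sumr_const card_ord /mean -[_ *+ k]mulr_natl mulrA divff ?mul1r ?subrr//.
by rewrite pnatr_eq0 -lt0n.
Qed.

(** With g = h - P h, one has -g^2 + 2 g h = h^2 - (P h)^2; by invariance its sum is that of P(h^2)
    - (P h)^2, the conditional variance. *)
Lemma sigma2E (f : 'I_k -> R) :
  let h i := r%:R * vsval ((laplacian0 R G r)^-1%VF (vsproj H0 (centered f))) i 0 in
  sigma2 G r f = k%:R^-1 * \sum_i \sum_j p i j * (h j - avg p h i) ^+ 2.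
Proof.
move=> h; have hg := poisson_equation (centered f) (centered_zero_sum f).
rewrite -/h in hg; congr (_ * _).
have -> : 2 * r%:R * quad0 (laplacian0 R G r)^-1%VF f =
    \sum_j 2 * (centered f j 0 * h j).
  rewrite /quad0 mxE mulr_sumr; apply: eq_bigr => j _; rewrite !mxE /h; ring.
rewrite -sumrN -big_split/=.
have E i : \sum_j p i j * (h j - avg p h i) ^+ 2 =
    avg p (fun j => h j ^+ 2) i - avg p h i ^+ 2.
  exact: (iter_avg_varianceE p (trans_row G r G_regular r_gt0) 1 h i).
under [RHS]eq_bigr do rewrite E.
rewrite sumrB (sum_iter_avg p (trans_col G r G_regular r_gt0) 1) -sumrB.
by apply: eq_bigr => j _; rewrite -hg; ring.
Qed.

Lemma sigma2_ge0 (f : 'I_k -> R) : 0 <= sigma2 G r f.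
Proof.
rewrite sigma2E mulr_ge0 ?invr_ge0//; apply: sumr_ge0 => i _; apply: sumr_ge0 => j _.
by rewrite mulr_ge0 ?sqr_ge0// trans_ge0.
Qed.

Lemma sigma2_quad0 (f : 'I_k -> R) :
  sigma2 G r f =
  k%:R^-1 * quad0 (- \1%VF + (2 * r%:R) *: (laplacian0 R G r)^-1%VF) f.
Proof.
congr (_ * _).
rewrite [in RHS]/quad0 add_lfunE opp_lfunE id_lfunE scale_lfunE.
rewrite linearD linearN linearZ/= vsprojK ?centered_zero_sum//.
rewrite [RHS]mxE; congr (_ + _); last by rewrite mxE.
by rewrite !mxE; congr (- _); apply: eq_bigr => j _; rewrite expr2 !mxE.
Qed.

(** The second equation is solvable because [sigma2] is the mean of the conditional variances, so
    the right side has zero sum. *)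
Lemma poisson_correctors (f : 'I_k -> R) : exists h b : 'I_k -> R,
  (forall i, h i - avg p h i = f i - mean f) /\
  (forall i, b i - avg p b i =
     \sum_j p i j * (h j - avg p h i) ^+ 2 - sigma2 G r f).
Proof.
have hg := poisson_equation (centered f) (centered_zero_sum f).
have sE := sigma2E f.
set h := fun i => _ in hg sE; cbv zeta in sE.
pose v : 'cV[R]_k := \col_i (\sum_j p i j * (h j - avg p h i) ^+ 2 - sigma2 G r f).
have vH : v \in H0.
  rewrite mem_zero_sum; under eq_bigr do rewrite mxE.
  rewrite sumrB sumr_const card_ord -[_ *+ k]mulr_natl sE mulrA divff ?mul1r ?subrr//.
  by rewrite pnatr_eq0 -lt0n.
have bv := poisson_equation v vH.
set b := fun i => _ in bv; exists h, b; split=> i; first by rewrite hg mxE.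
by rewrite bv mxE.
Qed.

End Laplacian.

(** * From smooth test functions to distribution functions *)

Section Limits.
Context {R : realType}.

Lemma ndist_tails (eta : R) : 0 < eta ->
  exists2 M : R, 0 < M & forall z, M <= z ->
    1 - ndist 1 z <= eta /\ ndist 1 (- z) <= eta.
Proof.
move=> eta0.
have /cvgrPdist_le/(_ _ eta0)[M1 [M1r H1]] := @cvg_ndist_pinfty R 1.
have /cvgrPdist_le/(_ _ eta0)[M2 [M2r H2]] := @cvg_ndist_ninfty R 1.
exists (1 + `|M1| + `|M2|) => [|z Mz]; first by rewrite -addrA ltr_wpDr// addr_ge0.
have := ler_norm M1; have := ler_norm (- M2); rewrite normrN.
have := normr_ge0 M1; have := normr_ge0 M2 => a1 a2 a3 a4.
split.
  by apply: le_trans (H1 z _); [exact: ler_norm | lra].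
have : `|0 - ndist 1 (- z)| <= eta by apply: H2; lra.
by rewrite sub0r normrN; apply: le_trans; apply: ler_norm.
Qed.

Lemma continuous_ndist1 : continuous (ndist (1 : R)).
Proof.
move=> x; apply/differentiable_continuous/derivable1_diffP.
by have [] := @is_derive_ndist1 R x.
Qed.

Lemma cvg_heat_right (v x s : R) : 0 < v ->
  heat (d ^+ 4 + v) (x + s * d) @[d --> 0^'+] --> heat v x.
Proof.
move=> v0.
apply: cvg_at_right_filter.
apply: (@cvg_comp _ _ _ (fun d => (x + s * d) * (Num.sqrt (d ^+ 4 + v))^-1) (ndist 1) _
  (nbhs (x * (Num.sqrt v)^-1))); last exact: continuous_ndist1.
apply: cvgM.
  rewrite -[X in _ --> X](addr0 x); apply: cvgD; first exact: cvg_cst.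
  by rewrite -[X in _ --> X](mulr0 s); apply: cvgMr; exact: cvg_id.
apply: cvgV; first by rewrite gt_eqF// sqrtr_gt0.
apply: (@cvg_comp _ _ _ (fun d => d ^+ 4 + v) Num.sqrt _ (nbhs v)); last exact: sqrt_continuous.
have -> : nbhs v = nbhs (0 ^+ 4 + v) by rewrite expr0n add0r.
apply: cvgD; last exact: cvg_cst.
exact: exprn_continuous.
Qed.

(** At v = 0 [heat] is not the step function: the inverse of 0 is 0, so it is the constant
    [ndist 1 0]. *)
Definition gauss_cdf (v x : R) : R := if v == 0 then (0 <= x)%R%:R else heat v x.

Lemma heat_expand (e z : R) : 0 < e -> heat (e ^+ 2) z = ndist 1 (z / e).
Proof. by move=> e0; rewrite /heat sqrtr_sqr gtr0_norm. Qed.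

Lemma heat_le1 (s z : R) : heat s z <= 1. Proof. exact: ndist_le1. Qed.
Lemma heat_ge0 (s z : R) : 0 <= heat s z. Proof. exact: ndist_ge0. Qed.

(** The smoothing has standard deviation d^2 and the shift is d: the shift tends to 0 and yet
    amounts to d^-1 standard deviations, so the tails vanish too. *)
Lemma smoothing_window (v x eta : R) : 0 <= v -> (v = 0 -> x != 0) -> 0 < eta ->
  exists2 d : R, 0 < d &
    [/\ heat (d ^+ 4 + v) (x + d) <= gauss_cdf v x + eta,
        gauss_cdf v x - eta <= heat (d ^+ 4 + v) (x - d),
        1 - ndist 1 d^-1 <= eta & ndist 1 (- d^-1) <= eta].
Proof.
move=> v0 vx eta0; have [M M0 HM] := ndist_tails eta eta0.
have tail d z : 0 < d -> d <= M^-1 -> d^-1 <= z ->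
    1 - ndist 1 z <= eta /\ ndist 1 (- z) <= eta.
  move=> d0 dM dz; apply: HM; apply: le_trans dz.
  by rewrite -[leLHS]invrK lef_pV2// posrE invr_gt0.
suff : \forall d \near (0:R)^'+, heat (d ^+ 4 + v) (x + d) <= gauss_cdf v x + eta /\
    gauss_cdf v x - eta <= heat (d ^+ 4 + v) (x - d).
  move=> H; near (0:R)^'+ => d.
  have d0 : 0 < d by near: d; apply: nbhs_right_gt.
  exists d => //.
  have [|T1 T2] := tail d d^-1 d0 _ (lexx _).
    by near: d; apply: nbhs_right_le; rewrite invr_gt0.
  have [H1 H2] : heat (d ^+ 4 + v) (x + d) <= gauss_cdf v x + eta /\
    gauss_cdf v x - eta <= heat (d ^+ 4 + v) (x - d) by near: d.
  by split.
rewrite /gauss_cdf; have [ve|vn0] := eqVneq v 0; last first.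
  have vp : 0 < v by rewrite lt_def vn0.
  have /cvgrPdist_le/(_ _ eta0) H1 := cvg_heat_right v x 1 vp.
  have /cvgrPdist_le/(_ _ eta0) H2 := cvg_heat_right v x (- 1) vp.
  near=> d.
  have : `|heat v x - heat (d ^+ 4 + v) (x + 1 * d)| <= eta by near: d.
  have : `|heat v x - heat (d ^+ 4 + v) (x + - 1 * d)| <= eta by near: d.
  rewrite mul1r mulN1r !ler_norml; lra.
have xn0 := vx ve; rewrite ve.
near=> d.
have d0 : 0 < d by near: d; apply: nbhs_right_gt.
have dM : d <= M^-1 by near: d; apply: nbhs_right_le; rewrite invr_gt0.
(* This keeps the shifted point on the side of [x], at distance at least d from the jump at 0. *)
have dx : d <= `|x| / 2 by near: d; apply: nbhs_right_le; rewrite divr_gt0 ?normr_gt0.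
have dd z : heat (d ^+ 4 + 0) z = ndist 1 (z / d ^+ 2).
  by rewrite addr0 (exprM d 2 2) heat_expand// exprn_gt0.
have ge z : d <= z -> d^-1 <= z / d ^+ 2.
  by move=> dz; rewrite ler_pdivlMr ?exprn_gt0// expr2 mulrA mulVf ?mul1r// gt_eqF.
rewrite !dd; have [x0|x0] := leP 0 x.
  rewrite (ger0_norm x0) in dx; split.
    by apply: le_trans (ndist_le1 _ _) _; rewrite lerDl ltW.
  by have [H _] := tail d _ d0 dM (ge (x - d) ltac:(lra)); rewrite /=; lra.
rewrite (ltr0_norm x0) in dx; split.
  have [_ H] := tail d _ d0 dM (ge (- (x + d)) ltac:(lra)).
  by rewrite add0r -[x + d]opprK mulNr.
by rewrite sub0r; apply: le_trans (ndist_ge0 _ _); rewrite oppr_le0 ltW.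
Unshelve. all: by end_near. Qed.

(** A smoothed step shifted by [d] can violate the comparison only by a Gaussian tail beyond d/e
    standard deviations. *)
Lemma indicator_sandwich (x y d e : R) : 0 < e ->
  heat (e ^+ 2) (x - d - y) - ndist 1 (- (d / e)) <= (y <= x)%R%:R <=
  heat (e ^+ 2) (x + d - y) + (1 - ndist 1 (d / e)).
Proof.
move=> e0; rewrite !heat_expand//; have [yx|xy] := leP y x; apply/andP; split => /=.
- have := ndist_le1 1 ((x - d - y) / e); have := ndist_ge0 1 (- (d / e)); lra.
- suff : ndist 1 (d / e) <= ndist 1 ((x + d - y) / e) by lra.
  by apply: ndist_mono; rewrite ler_pM2r ?invr_gt0//; lra.
- suff : ndist 1 ((x - d - y) / e) <= ndist 1 (- (d / e)) by lra.
  by apply: ndist_mono; rewrite -mulNr ler_pM2r ?invr_gt0//; lra.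
- have := ndist_ge0 1 ((x + d - y) / e); have := ndist_le1 1 (d / e); lra.
Qed.

Lemma unif_law_sandwich (T : finType) (W : {set T}) (Y : T -> R) (x d e : R) :
    (0 < #|W|)%N -> 0 < e ->
  exists2 F : R, unif_law W Y `]-oo, x]%classic = F%:E &
    (\sum_(w in W) heat (e ^+ 2) (x - d - Y w)) / #|W|%:R - ndist 1 (- (d / e)) <= F <=
    (\sum_(w in W) heat (e ^+ 2) (x + d - Y w)) / #|W|%:R + (1 - ndist 1 (d / e)).
Proof.
move=> W0 e0; eexists; first by [].
have Wn0 : #|W|%:R != 0 :> R by rewrite pnatr_eq0 -lt0n.
have -> : #|[pred w in W | Y w \in `]-oo, x]%classic]|%:R = \sum_(w in W) (Y w <= x)%R%:R :> R.
  rewrite -sum1_card natr_sum.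
  transitivity (\sum_(w in W | Y w <= x) (1:R)); last first.
    by rewrite big_mkcondr/=; apply: eq_bigr => w _; case: (Y w <= x).
  by apply: eq_bigl => w; rewrite !inE/= mem_setE in_itv.
have cst (a : R) : a = (\sum_(w in W) a) / #|W|%:R.
  by rewrite sumr_const -[_ *+ _]mulr_natl mulrAC divff// mul1r.
rewrite [ndist 1 (- (d / e))]cst [1 - ndist 1 (d / e)]cst -mulrBl -mulrDl -sumrB -big_split/=.
by apply/andP; split; apply: ler_wpM2r; rewrite ?invr_ge0//; apply: ler_sum => w _;
  have /andP[] := indicator_sandwich x (Y w) d e e0.
Qed.

End Limits.

(** * The central limit theorem for closed walks *)

Lemma invsqrt_small {R : realType} (e : R) : 0 < e ->
  exists N0, forall N, (N0 < N)%N -> (Num.sqrt N%:R)^-1 <= e.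
Proof.
move=> e0; exists (Num.bound (e ^- 2)) => N N0.
have NR : 0 < N%:R :> R by rewrite ltr0n (leq_ltn_trans _ N0).
rewrite -[leRHS]invrK lef_pV2 ?posrE ?invr_gt0 ?sqrtr_gt0//.
rewrite -[leLHS]gtr0_norm ?invr_gt0// -sqrtr_sqr ler_sqrt// exprVn ltW//.
apply: (@lt_trans _ _ (Num.bound (e ^- 2))%:R); last by rewrite ltr_nat.
by apply: archi_boundP; rewrite invr_ge0 exprn_ge0// ltW.
Qed.

Section CentralLimit.
Context {R : realType} {k : nat}.
Variables (G : digraph k) (r : nat) (f : 'I_k -> R).
Hypothesis G_regular : regular G r.
Hypothesis G_connected : connected_graph G.
Hypothesis r_gt0 : (0 < r)%N.
Hypothesis k_gt0 : (0 < k)%N.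

Local Notation p := (trans R G r).
Local Notation sigma2 := (sigma2 G r f).

Let Y N (w : N.-tuple (edge G)) : R := (walk_sum f w - N%:R * mean f) / Num.sqrt N%:R.

Let YE N (w : N.-tuple (edge G)) :
  Y N w = \sum_(l < N) (f (source (tnth w l)) - mean f) / Num.sqrt N%:R.
Proof. by rewrite /Y -mulr_suml sumrB sumr_const card_ord mulr_natl. Qed.

(** The walks closing at [i] contribute nearly the Gaussian value times P^N(i,i), by decoupling and
    [chain_clt]. Division by the trace is harmless because the trace is at least [c]. *)
Lemma smoothed_clt (s0 x eta : R) : 0 < s0 -> 0 < eta ->
  exists N0, forall N, (N0 < N)%N -> (0 < #|closed_walks G N|)%N ->
  `|(\sum_(w in closed_walks G N) heat s0 (x - Y N w)) / #|closed_walks G N|%:R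
    - heat (s0 + sigma2) x| <= eta.
Proof.
move=> s00 eta0.
have p0 := @trans_ge0 R k G r; have prow := @trans_row R k G r G_regular r_gt0.
have pcol := @trans_col R k G r G_regular r_gt0.
have pconn := @trans_connected R k G r r_gt0 G_connected.
have [h [b [hg bv]]] := poisson_correctors G r G_regular r_gt0 k_gt0 G_connected f.
have sig0 := sigma2_ge0 G r G_regular r_gt0 k_gt0 G_connected f.
have [C C0 HC] := chain_clt p p0 prow (fun i => f i - mean f) h b sigma2 s0 hg bv sig0 s00.
have [K K0 HK] := heat_bounds s0 s00.
have [c c0 [N1 HN1]] := pn_lower_bound p p0 prow pcol pconn.
pose phi y := heat s0 (x - y).
have phiK z a : `|phi (z + a) - phi z| <= K * `|a|.
  have [_ + _ _ _] := HK s0 (x - z) (- a) 0 (lexx _) (lexx _).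
  by rewrite normrN /phi opprD addrA.
have phi1 z : `|phi z| <= 1 by rewrite ger0_norm ?heat_ge0 ?heat_le1.
pose B := \sum_j `|f j - mean f|.
have gB j : `|f j - mean f| <= B by rewrite /B (bigD1 j)//= lerDl sumr_ge0.
have B0 : 0 <= B by apply: sumr_ge0.
have kR : 0 < k%:R :> R by rewrite ltr0n.
(* The k vertices, each with error 2 eta1, add up to eta c, which is at most eta times the trace. *)
pose eta1 := eta * c / (2 * k%:R).
have eta10 : 0 < eta1 by rewrite divr_gt0 ?mulr_gt0.
have u1 (i j : 'I_k) : `|(j == i)%:R : R| <= 1 by case: (j == i); rewrite ?normr1 ?normr0.
have /choice[L HL] := fun i => iter_step_decouple p p0 prow pcol phi
  (fun j => (j == i)%:R) K eta1 phiK phi1 (u1 i) (ltW K0) eta10.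
pose Lm := \max_i L i.
(* [D] collects the coefficients of N^(-1/2) in the decoupling error, uniformly in [i], and in the
   error of [chain_clt]. *)
pose D := 2 * (Lm%:R * (K * B)) + C.
have D0 : 0 <= D by rewrite addr_ge0// !mulr_ge0// ltW.
have [N2 HN2] := invsqrt_small (eta1 / (1 + D)) (divr_gt0 eta10 (ltr_wpDr D0 ltr01)).
exists (maxn Lm (maxn N1 N2)) => N; rewrite !gtn_max => /and3P[NL NN1 NN2] W0.
have N0 : (0 < N)%N by apply: leq_ltn_trans NL.
pose t : R := (Num.sqrt N%:R)^-1.
have t0 : 0 <= t by rewrite invr_ge0 sqrtr_ge0.
have tD : t * D <= eta1.
  have : t <= eta1 / (1 + D) by apply: HN2.
  rewrite ler_pdivlMr ?ltr_wpDr// mulrDr mulr1; lra.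
pose ct j := (f j - mean f) / Num.sqrt N%:R.
pose X i := iter N (step p ct) (fun l z => phi z * (l == i)%:R) i 0.
have rN : 0 < r%:R ^+ N :> R by rewrite exprn_gt0 ?ltr0n.
pose Z := \sum_i pn p N i i.
have -> : (\sum_(w in closed_walks G N) heat s0 (x - Y N w)) / #|closed_walks G N|%:R
    = (\sum_i X i) / Z.
  rewrite (card_closed_walks G r r_gt0)//.
  rewrite (eq_bigr (fun w : N.-tuple (edge G) => phi (\sum_(l < N) ct (source (tnth w l))))); last first.
    by move=> w _; rewrite /phi YE.
  rewrite (sum_closed_walksE G r r_gt0)// -/Z.
  by rewrite invfM mulrACA divff ?gt_eqF// mul1r.
have pnge i j : 0 <= pn p N i j by apply: (pn_ge0 p p0 prow).
have [i0 Hi0] : exists i, 0 < pn p N i i.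
  exact/(closed_walks_gt0 G r G_regular r_gt0 N N0).
have Zc : c <= Z.
  apply: le_trans (HN1 N i0 (ltnW NN1) Hi0) _.
  by rewrite /Z (bigD1 i0)//= lerDl; apply: sumr_ge0.
have Z0 : 0 < Z by apply: lt_le_trans Zc.
set gl := heat _ x.
have each i : `|X i - gl * pn p N i i| <= 2 * eta1.
  have ctB j : `|ct j| <= B * t.
    rewrite /ct normrM (ger0_norm t0); exact: ler_wpM2r.
  have LN : (L i <= N)%N by apply: leq_trans (ltnW NL); apply: leq_bigmax.
  have H1 := HL i N ct (B * t) i 0 LN ctB.
  rewrite -/(X i) -/(pn p N i i) in H1.
  have H2 := HC N x i N0.
  rewrite -/gl -/(phi) -/ct in H2.
  set V := iter N (step p ct) (fun _ z => phi z) i 0 in H1.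
  have {}H2 : `|V - gl| <= C * t by exact: H2.
  have p1 : `|pn p N i i| <= 1 by apply: iter_avg_norm_le => //; exact: u1.
  have H3 : `|pn p N i i * (V - gl)| <= C * t.
    by rewrite normrM; apply: le_trans H2; rewrite ler_piMl.
  have -> : X i - gl * pn p N i i = (X i - pn p N i i * V) + pn p N i i * (V - gl) by ring.
  have LL : 2 * ((L i)%:R * (K * (B * t))) <= 2 * (Lm%:R * (K * B)) * t.
    rewrite -mulrA ler_pM2l// -!mulrA ler_wpM2r ?ler_nat ?leq_bigmax//.
    by rewrite !mulr_ge0// ltW.
  apply: le_trans (ler_normD _ _) _.
  by move: tD; rewrite /D mulrDr; lra.
rewrite -[gl](mulfK (lt0r_neq0 Z0)) -mulrBl normrM (ger0_norm (x := Z^-1)) ?invr_ge0 ?(ltW Z0)//.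
rewrite ler_pdivrMr// /Z mulr_sumr -sumrB.
apply: le_trans (ler_norm_sum _ _ _) _.
apply: (@le_trans _ _ (\sum_(i < k) 2 * eta1)); first by apply: ler_sum => i _; apply: each.
rewrite sumr_const card_ord -[_ *+ k]mulr_natl.
have -> : k%:R * (2 * eta1) = eta * c by rewrite /eta1; field; rewrite gt_eqF.
by rewrite ler_pM2l.
Qed.

Lemma unif_law_cdf (x eta : R) : (sigma2 = 0 -> x != 0) -> 0 < eta ->
  exists N0, forall N, (N0 < N)%N -> (0 < #|closed_walks G N|)%N ->
  exists2 F : R, unif_law (closed_walks G N) (Y N) `]-oo, x]%classic = F%:E &
    `|gauss_cdf sigma2 x - F| <= eta.
Proof.
move=> sx eta0; have sig0 := sigma2_ge0 G r G_regular r_gt0 k_gt0 G_connected f.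
(* The three parts pay for the smoothing window, the Gaussian tail and the smoothed limit
   theorem. *)
have eta3 : 0 < eta / 3 by rewrite divr_gt0.
have [d d0 [H1 H2 H3 H4]] := smoothing_window sigma2 x (eta / 3) sig0 sx eta3.
have d40 : 0 < d ^+ 4 by rewrite exprn_gt0.
have [Na HNa] := smoothed_clt (d ^+ 4) (x + d) (eta / 3) d40 eta3.
have [Nb HNb] := smoothed_clt (d ^+ 4) (x - d) (eta / 3) d40 eta3.
exists (maxn Na Nb) => N; rewrite gtn_max => /andP[/HNa Ha /HNb Hb] W0.
have d20 : 0 < d ^+ 2 by rewrite exprn_gt0.
have [F FE /andP[Fl Fu]] := unif_law_sandwich _ (closed_walks G N) (Y N) x d (d ^+ 2) W0 d20.
exists F => //; have {Ha} := Ha W0; have {Hb} := Hb W0.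
have dd : d / d ^+ 2 = d^-1 by field; rewrite gt_eqF.
rewrite dd -exprM in Fl Fu; rewrite !ler_norml; lra.
Qed.

Lemma normal_law_cdf (x : R) :
  normal_law sigma2 `]-oo, x]%classic = (gauss_cdf sigma2 x)%:E.
Proof.
have sig0 := sigma2_ge0 G r G_regular r_gt0 k_gt0 G_connected f.
rewrite /normal_law /gauss_cdf; case: eqVneq => [_|sn0].
  by rewrite diracE mem_setE in_itv.
rewrite ndistE ndist_scale//.
by rewrite sqrtr_gt0 lt_def sn0.
Qed.

End CentralLimit.

(** The left limit is 0 but the value is 1; this excludes x = 0 when the limit is a point mass. *)
Lemma dirac_cdf_discontinuous (R : realType) :
  ~ {for (0 : R), continuous (fun t : R => (\d_(0 : R) `]-oo, t]%classic : \bar R))}.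
Proof.
move=> cont.
have H1 : \d_(0 : R) `]-oo, t]%classic @[t --> (0:R)^'-] --> (1%:E : \bar R).
  have := cvg_at_left_filter cont.
  by rewrite diracE mem_setE in_itv /= lexx.
have H0 : \d_(0 : R) `]-oo, t]%classic @[t --> (0:R)^'-] --> (0%:E : \bar R).
  apply: cvg_near_cst; near=> t.
  by rewrite diracE mem_setE in_itv /= leNgt (_ : t < 0)//; near: t; apply: nbhs_left_lt.
have E : 1%:E = 0%:E :> \bar R by apply: (cvg_unique (@ereal_hausdorff R) H1 H0).
by move/eqP: E; rewrite eqe oner_eq0.
Unshelve. all: by end_near. Qed.

(** A graph without arcs is bipartite for any colouring, so there is an arc. *)
Lemma nonbipartite_gt0 (k r : nat) (G : digraph k) :
  regular G r -> ~ bipartite G -> (0 < k)%N /\ (0 < r)%N.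
Proof.
move=> [Grow _] nbip.
have [e] : exists e : edge G, True.
  apply: contrapT => Ne; apply: nbip; exists (fun=> true) => e.
  by exfalso; apply: Ne; exists e.
move=> _; split; first exact: leq_ltn_trans (ltn_ord (source e)).
rewrite -(Grow (source e)) (bigD1 (target e))//= ltn_addr//.
by apply/card_gt0P; exists e; rewrite inE !eqxx.
Qed.

Theorem theorem7p1 (R : realType) (k r : nat) (G : digraph k) (f : 'I_k -> R)
    (G_connected : connected_graph G) (G_regular : regular G r)
    (G_nonbip : ~ bipartite G) :
  (* the data of the conclusion are well defined *)
  [/\ infinite_set [set N : nat | (0 < #|closed_walks G N|)%N],
      undirected G -> \forall N \near \oo, (0 < #|closed_walks G N|)%N,
      lker (laplacian0 R G r) == 0%VS
    & 0 <= sigma2 G r f] /\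
  (* the two expressions of the variance agree *)
  sigma2 G r f =
    k%:R^-1 * quad0 (- \1%VF + (2 * r%:R) *: (laplacian0 R G r)^-1%VF) f /\
  (* convergence in distribution, along the lengths N with W_N nonempty *)
  cvg_in_law (within [set N : nat | (0 < #|closed_walks G N|)%N] \oo)
    (fun N => unif_law (closed_walks G N)
       (fun w => (walk_sum f w - N%:R * mean f) / Num.sqrt N%:R))
    (normal_law (sigma2 G r f)).
Proof.
have [k0 r0] := nonbipartite_gt0 k r G G_regular G_nonbip.
have i0 : 'I_k by exact: Ordinal k0.
split; first split.
- exact: (@infinitely_many_closed_walks R _ _ _ G_regular r0 G_connected i0).
- by move=> und; apply: (@undirected_closed_walks R _ _ _ G_regular r0 G_connected i0).
- exact: laplacian0_inj.
- exact: sigma2_ge0.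
split; first exact: sigma2_quad0.
move=> x xcont; rewrite (normal_law_cdf G r)//.
have sx : sigma2 G r f = 0 -> x != 0.
  move=> s0; apply/eqP => x0; move: xcont; rewrite x0 s0 /normal_law eqxx.
  exact: dirac_cdf_discontinuous.
apply: cvg_EFin.
  by near=> N.
apply/cvgrPdist_le => eta eta0.
have [N0 HN0] := unif_law_cdf G r f G_regular G_connected r0 k0 x eta sx eta0.
(* The bound requires N0 < N, hence the successor. *)
rewrite near_withinE; exists N0.+1 => //= N NN W0.
by have [F FE] := HN0 N NN W0; rewrite -[F]/(fine F%:E) -FE.
Unshelve. all: by end_near. Qed.
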